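(* For all positive integers $d_x$ and $h$ there exists a constant $C=C(d_x,h)>0$ such that the following holds. Let $d_y$ be an integer with $d_x\geq d_y\geq 1$, let $t,s\geq 1$ and $n\geq 3$ be integers, and let $\Gamma$ be an $n$-vertex $K_{s,s}$-free semilinear graph of dimension $(d_x,d_y)$ and complexity $(h,t)$. Then $$e(\Gamma)\leq C\, t\, s\, n\left(\frac{\log n}{\log\log n}\right)^{d_y-1}.$$
   Context: A bipartite graph $\Gamma$ is semilinear of dimension $(d_x,d_y)$ and complexity $(h,t)$ if its vertex classes are finite sets $X\subset\mathbb{R}^{d_x}$ and $Y\subset\mathbb{R}^{d_y}$, and there are $ht$ linear functions (i.e. polynomials of degree at most one, constant terms allowed) $f_{i,j}:\mathbb{R}^{d_x}\times\mathbb{R}^{d_y}\to\mathbb{R}$, $(i,j)\in[h]\times[t]$, such that $x\in X$ and $y\in Y$ are adjacent if and only if $$\bigvee_{j\in[t]}\bigwedge_{i\in[h]}\{f_{i,j}(x,y)\leq 0\}=\text{true},$$ i.e. there is $j\in[t]$ with $f_{i,j}(x,y)\le 0$ for all $i\in[h]$. $e(\Gamma)$ denotes the number of edges. $K_{s,s}$-free means containing no complete bipartite graph with both parts of size $s$ as a subgraph. $\log$ is the natural logarithm. *)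

(* Defs.v *)
From HB Require Import structures.
From mathcomp Require Import all_boot all_order all_algebra.
From mathcomp Require Import finmap.
From mathcomp Require Import reals exp.

Set Implicit Arguments.
Unset Strict Implicit.
Unset Printing Implicit Defensive.

Import Order.TTheory GRing.Theory Num.Theory.

Local Open Scope ring_scope.

(* The two vertex classes are made disjoint by using their sum as vertex type
   below, so they may overlap as point sets when U = V. *)
Record bipartite_graph (U V : choiceType) := BipartiteGraph {
  lclass : {fset U};
  rclass : {fset V};
  adj : lclass -> rclass -> bool
}.

Section BipartiteGraph.
Variables (U V : choiceType) (G : bipartite_graph U V).

Definition vertex : finType := (lclass G + rclass G)%type.

Definition edge_rel : rel vertex := fun u v =>
  match u, v with
  | inl x, inr y => adj x y
  | inr y, inl x => adj x y
  | _, _ => false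
  end.

Definition num_edges : nat :=
  #|[set p : lclass G * rclass G | adj p.1 p.2]|.

End BipartiteGraph.

Arguments vertex {U V} G.
Arguments edge_rel {U V} G u v.

Definition Kss_free (s : nat) (T : finType) (e : rel T) : Prop :=
  ~ exists A B : {set T},
      [/\ #|A| = s, #|B| = s, [disjoint A & B] & {in A & B, forall u v, e u v}].

Section Semilinear.
Variable R : realType.

(* Polynomial functions of degree at most one on R^dx * R^dy. *)
Definition affine_fun (dx dy : nat) (f : 'rV[R]_dx * 'rV[R]_dy -> R) : Prop :=
  exists (a : 'rV[R]_dx) (b : 'rV[R]_dy) (c : R),
    forall x y,
      f (x, y) = \sum_(k < dx) a 0 k * x 0 k + \sum_(k < dy) b 0 k * y 0 k + c.

Definition semilinear_graph (dx dy h t : nat)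
    (G : bipartite_graph 'rV[R]_dx 'rV[R]_dy) : Prop :=
  exists f : 'I_h -> 'I_t -> 'rV[R]_dx * 'rV[R]_dy -> R,
    (forall i j, affine_fun (f i j)) /\
    (forall (x : lclass G) (y : rclass G),
       adj x y <-> exists j, forall i, f i j (val x, val y) <= 0).

End Semilinear.

Arguments semilinear_graph {R dx dy} h t G.

(* Main.v *)
Require Import Defs.
From HB Require Import structures.
From mathcomp Require Import all_boot all_order all_algebra.
From mathcomp Require Import finmap.
From mathcomp Require Import boolp reals exp.
From mathcomp Require Import lra ring zify.

(** For a fixed disjunct, [f_i(x, y) <= 0] for all [i] says that [y] lies in a
    polyhedron [P_x = {y : l_i(y) <= u_i(x)}] whose normals do not depend on
    [x].  The edges are thus incidences between points and polyhedra with [h]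
    fixed normals in dimension [d = d_y], and a union over the disjuncts costs
    the factor [t].

    The number [h] is eliminated first.  A bounded polyhedron with fixed normals
    is a union of parallelotopes whose number depends only on [d] and [h] and
    whose directions do not depend on [x] ([polyhedron_cover]).  A triangle, for
    instance, is covered by three parallelograms, each with one corner of the
    triangle and the midpoints of the sides as vertices, although it cannot be
    cut into parallelograms.  In general one eliminates the last coordinate: the
    polyhedron becomes a bounded union of regions between two affine graphs over
    polyhedra of one dimension less, by induction over parallelotopes, and such
    a region falls into products of a triangle with intervals ([cover_target]).
    Each family of parallelotopes is a family of boxes in suitable linear
    coordinates, and its incidences form a subgraph of the given graph, again
    without a complete bipartite subgraph.

    For [n] points and boxes in dimension [d], the bound is of order
    [s n (log n / log log n)^(d - 1)].  For [d = 1], and also for ranges with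
    three sides in the plane, it is linear: insert the points in the order of
    the one-sided coordinate and keep a partition into blocks, split when they
    reach [2 s] points; each block has a core of [s] points, so fewer than [s]
    ranges contain it ([three_sided_linear]).  A further coordinate is treated
    by a tree of branching [b] and depth [D], with [b^D >= n].  At every level a
    point lies in one slab, whereas a box is cut by at most two slabs and spans
    at most [b] children of each.  Points therefore pay a factor [D] and boxes a
    factor [D b] ([controlled_succ]); in the plane boxes pay only [b], being
    charged at the node where their ends separate ([controlled2]).  Altogether
    points cost [D^(d - 1)] and boxes [D^(d - 2) b^(d - 1)], and both are of
    order [(log n / log log n)^(d - 1)] when [b] is a small power of [log n]
    ([tree_parameters]). *)

Set Implicit Arguments.
Unset Strict Implicit.
Unset Printing Implicit Defensive.

Import Order.TTheory GRing.Theory Num.Theory.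

(** * Three-sided ranges *)

Section Edges.
Variables (X Y : finType).
Implicit Types (e : X -> Y -> bool) (A S : {set X}) (B T : {set Y}).

Definition edges e A B : nat := \sum_(x in A) \sum_(y in B) e x y.

(** At least [s] rather than exactly [s] on both sides: the two versions agree,
    and with this one a large common neighbourhood is a contradiction as it
    stands. *)
Definition biclique_free (s : nat) e :=
  forall S T, s <= #|S| -> s <= #|T| -> ~ {in S & T, forall x y, e x y}.

Lemma edges_splitl e A B (P : pred X) :
  edges e A B = edges e [set x in A | P x] B + edges e [set x in A | ~~ P x] B.
Proof.
rewrite /edges (bigID P) /=; congr (_ + _); apply: eq_bigl => x;
  by rewrite !inE.
Qed.

Lemma edges_splitr e A B (P : pred Y) :
  edges e A B = edges e A [set y in B | P y] + edges e A [set y in B | ~~ P y].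
Proof.
rewrite /edges -big_split /=; apply: eq_bigr => x _.
rewrite (bigID P) /=; congr (_ + _); apply: eq_bigl => y;
  by rewrite !inE.
Qed.

Lemma card_split (U : finType) (C : {set U}) (P : pred U) :
  #|C| = #|[set x in C | P x]| + #|[set x in C | ~~ P x]|.
Proof.
rewrite -(cardsID [set x | P x] C); congr (_ + _); apply: eq_card => x;
  by rewrite !inE // andbC.
Qed.

Lemma edges_bound e A B k :
  {in A, forall x, #|[set y in B | e x y]| <= k} -> edges e A B <= #|A| * k.
Proof.
move=> h; rewrite -sum_nat_const; apply: leq_sum => x xA.
rewrite (leq_trans _ (h x xA)) // -sum1_card big_mkcond [X in _ <= X]big_mkcond /=.
by apply: leq_sum => y _; rewrite inE; case: (y \in B); case: (e x y).
Qed.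

Lemma edges0 e A B : {in A & B, forall x y, ~~ e x y} -> edges e A B = 0.
Proof.
move=> h; rewrite /edges big1 // => x xA; rewrite big1 // => y yB.
by rewrite (negbTE (h x y xA yB)).
Qed.

Lemma sum_slice (U : finType) (C : {set U}) b (key : U -> nat) (F : U -> nat) :
  {in C, forall y, key y < b} ->
  \sum_(y in C) F y = \sum_(i < b) \sum_(y in [set y in C | key y == i]) F y.
Proof.
case: b => [|b] kb.
  by rewrite big_ord0 big1 // => y /kb.
rewrite (partition_big (fun y => inord (key y) : 'I_b.+1) predT) //=.
apply: eq_bigr => i _; apply: eq_bigl => y; rewrite inE.
by case yC: (y \in C) => //=; rewrite -val_eqE /= inordK // kb.
Qed.

Lemma edges_slice e A B b (key : Y -> nat) :
  {in B, forall y, key y < b} ->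
  edges e A B = \sum_(i < b) edges e A [set y in B | key y == i].
Proof.
move=> kb; rewrite /edges exchange_big /= (sum_slice _ kb).
by apply: eq_bigr => i _; rewrite exchange_big.
Qed.

Lemma card_slice (U : finType) (C : {set U}) b (key : U -> nat) :
  {in C, forall y, key y < b} ->
  #|C| = \sum_(i < b) #|[set y in C | key y == i]|.
Proof.
move=> kb; rewrite -sum1_card (sum_slice _ kb).
by apply: eq_bigr => i _; rewrite sum1_card.
Qed.

End Edges.

Section Initial.
Variable (Y : finType).

(** Adding the elements of [Z] in increasing order of [q] raises the count by
    one at each step, so every size up to [#|Z|] occurs.  Describing the first
    [k] elements by a threshold [v] lets them be compared with the thresholds
    that define the ranges. *)
Lemma initial_segment (q : Y -> nat) (Z : {set Y}) k :
  injective q -> k <= #|Z| -> exists v, #|[set z in Z | q z < v]| = k.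
Proof.
move=> qI; elim: k => [|k IH] kZ.
  by exists 0; apply/eqP; rewrite cards_eq0; apply/eqP/setP => z; rewrite !inE andbF.
have [v hv] := IH (ltnW kZ).
have [z0 z0P] : exists z0, z0 \in [set z in Z | ~~ (q z < v)].
  apply/set0Pn; rewrite -card_gt0.
  by have := card_split Z (fun z => q z < v); lia.
move: z0P; rewrite inE => z0P.
case: (@arg_minnP _ z0 (fun z => (z \in Z) && ~~ (q z < v)) q z0P) => z /andP[zZ vz] zmin.
exists (q z).+1; rewrite -hv.
have -> : [set z' in Z | q z' < (q z).+1] = z |: [set z' in Z | q z' < v].
  apply/setP => z'; rewrite !inE; case: (eqVneq z' z) => [->|zz'] /=.
    by rewrite zZ ltnS leqnn.
  case z'Z: (z' \in Z) => //=; rewrite ltnS leq_eqVlt.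
  have -> : (q z' == q z) = false by apply/eqP => /qI /eqP; rewrite (negbTE zz').
  case: (ltnP (q z') v) => /= h; first by lia.
  by have := zmin z'; rewrite z'Z -leqNgt h => /(_ isT); lia.
by rewrite cardsU1 inE zZ (negbTE vz).
Qed.
End Initial.

Section ThreeSided.
Variables (X Y : finType) (s : nat) (e : X -> Y -> bool).
Hypotheses (s_gt0 : 0 < s) (efree : biclique_free s e).
Variables (r q : Y -> nat) (lo hi top : X -> nat).
Hypotheses (rI : injective r) (qI : injective q).

(** The boundary [v] of a range separates two points of [Z]; a range neither
    of whose ends cuts [Z] contains all of [Z] or none of it in the
    [r]-direction. *)
Definition cuts (v : nat) (Z : {set Y}) : bool :=
  [exists z in Z, r z < v] && [exists z in Z, v <= r z].

Definition spans x (Z : {set Y}) := [forall z in Z, lo x <= r z < hi x].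

Definition three_sided x y := [&& lo x <= r y, r y < hi x & q y < top x].

Definition ncuts x Z : nat := cuts (lo x) Z + cuts (hi x) Z.

Lemma cutsF v Z : ~~ cuts v Z ->
  {in Z, forall z, r z < v} \/ {in Z, forall z, v <= r z}.
Proof.
rewrite negb_and => /orP[|] /existsPn h; [right|left] => z zZ;
  by have := h z; rewrite zZ /=; lia.
Qed.

(** Every boundary cuts at most one of two consecutive blocks, so the total
    number of cuts does not grow when blocks are split. *)
Lemma cuts_split v w (Z : {set Y}) :
  cuts v [set z in Z | r z < w] + cuts v [set z in Z | ~~ (r z < w)] <= cuts v Z.
Proof.
have mono (Z1 : {set Y}) : Z1 \subset Z -> cuts v Z1 -> cuts v Z.
  move=> /subsetP sub /andP[/existsP[a /andP[aZ ha]] /existsP[c /andP[cZ hc]]].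
  by apply/andP; split; apply/existsP; [exists a|exists c];
    rewrite ?(sub _ aZ) ?(sub _ cZ).
have subI (P : pred Y) : [set z in Z | P z] \subset Z.
  by apply/subsetP => z; rewrite inE => /andP[].
case c1: (cuts v [set z in Z | r z < w]); case c2: (cuts v [set z in Z | ~~ (r z < w)]) => //=.
- case/andP: c1 => _ /existsP[a]; rewrite !inE -!andbA => /and3P[_ h1 h2].
  case/andP: c2 => /existsP[c]; rewrite !inE -!andbA => /and3P[_ h3 h4] _.
  lia.
- by rewrite (mono _ _ c1).
- by rewrite (mono _ _ c2).
Qed.

Lemma ncuts_split x w (Z : {set Y}) :
  ncuts x [set z in Z | r z < w] + ncuts x [set z in Z | ~~ (r z < w)]
    <= ncuts x Z.
Proof.
by have := cuts_split (lo x) w Z; have := cuts_split (hi x) w Z; rewrite /ncuts; lia.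
Qed.

(** Vertices of degree at most [k] are cheap: those cutting [Z] are paid for
    by their cuts, and those spanning [Z] are few. *)
Lemma edges_terminal (A : {set X}) (Z : {set Y}) k :
  {in A & Z, forall x y, e x y = three_sided x y} ->
  {in A, forall x, #|[set y in Z | e x y]| <= k} ->
  #|[set x in A | spans x Z]| <= s ->
  edges e A Z <= k * (\sum_(x in A) ncuts x Z) + k * s.
Proof.
move=> eE deg few.
rewrite (edges_splitl _ _ _ (fun x => spans x Z)) addnC leq_add //; last first.
  rewrite (leq_trans (edges_bound (k := k) _)) //.
    by move=> x; rewrite inE => /andP[/deg].
  by rewrite mulnC leq_mul2l few orbT.
rewrite big_distrr /= (big_setID [set x in A | ~~ spans x Z]) /= (setIidPr _); last first.
  by apply/subsetP => x; rewrite inE => /andP[].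
rewrite (leq_trans _ (leq_addr _ _)) //; apply: leq_sum => x; rewrite inE => /andP[xA nsp].
case: (posnP (ncuts x Z)) => [/eqP|npos]; last first.
  rewrite (leq_trans _ (leq_pmulr _ npos)) // (leq_trans _ (deg x xA)) //.
  rewrite -sum1_card big_mkcond [X in _ <= X]big_mkcond /=.
  by apply: leq_sum => y _; rewrite inE; case: (y \in Z); case: (e x y).
rewrite addn_eq0 !eqb0 => /andP[/cutsF c1 /cutsF c2].
rewrite big1 // => y yZ; apply/eqP; rewrite eqb0 eE // /three_sided.
case: c1 => c1; first by have := c1 _ yZ; lia.
case: c2 => c2; last by have := c2 _ yZ; lia.
by move: nsp => /negP[]; apply/forallP => z; apply/implyP => zZ; rewrite c1 ?c2.
Qed.

(** The linear bound, on one block of a dynamic partition: points are inserted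
    in increasing order of [q], and a block that has received [2 * s] points is
    split at their [r]-median, so that each new block is born with a core of
    [s] points.  A range that stops before the split sees at most [2 * s]
    points of the block.  A range that goes on and spans one of the new blocks
    contains its core, and by the absence of bicliques there are fewer than
    [s] such ranges.  The term [2 * s * s] on the left is a
    potential: the two blocks after a split contribute it twice, and one of the
    two copies pays for the edges of the fewer than [s] spanning ranges that
    stop. *)
Lemma three_sided_rec (A : {set X}) (Z : {set Y}) :
  {in A & Z, forall x y, e x y = three_sided x y} ->
  s <= #|Z| -> #|[set x in A | spans x Z]| < s ->
  edges e A Z + 2 * s * s <= 4 * s * #|Z| + 2 * s * \sum_(x in A) ncuts x Z.
Proof.
move: {2}#|Z| (leqnn #|Z|) => N; elim: N A Z => [|N IH] A Z leN eE sZ few.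
  lia.
case: (leqP #|Z| (2 * s)) => [small|big].
  have := edges_terminal eE (k := 2 * s) _ (ltnW few).
  have deg x : x \in A -> #|[set y in Z | e x y]| <= 2 * s.
    move=> _; rewrite (leq_trans _ small) // subset_leq_card //.
    by apply/subsetP => y; rewrite inE => /andP[].
  by move/(_ deg); nia.
(* Z0: the first 2s points in insertion order; w: their r-median. *)
have [v hv] := initial_segment qI (ltnW big).
set Z0 := [set z in Z | q z < v] in hv.
have [w hw] : exists w, #|[set z in Z0 | r z < w]| = s.
  by apply: initial_segment => //; lia.
have hw' : #|[set z in Z0 | ~~ (r z < w)]| = s.
  by have := card_split Z0 (fun z => r z < w); lia.
(* At: ranges that stop before all of Z0 has been inserted; Ap: the others. *)
pose At := [set x in A | top x < v]; pose Ap := [set x in A | ~~ (top x < v)].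
pose ZL := [set z in Z | r z < w]; pose ZR := [set z in Z | ~~ (r z < w)].
have term : edges e At Z <= 2 * s * (\sum_(x in At) ncuts x Z) + 2 * s * s.
  apply: edges_terminal.
  - by move=> x y; rewrite inE => /andP[xA _] yZ; apply: eE.
  - move=> x; rewrite inE => /andP[xA tx]; rewrite -hv subset_leq_card //.
    apply/subsetP => y; rewrite !inE => /andP[yZ]; rewrite eE // yZ => /and3P[_ _ h].
    by lia.
  - rewrite ltnW // (leq_ltn_trans _ few) // subset_leq_card //.
    by apply/subsetP => x; rewrite !inE -andbA => /and3P[-> _ ->].
have pass (P : pred Y) : #|[set z in Z0 | P z]| = s -> #|[set z in Z | ~~ P z]| > 0 ->
    edges e Ap [set z in Z | P z] + 2 * s * s <= 4 * s * #|[set z in Z | P z]| +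
      2 * s * \sum_(x in Ap) ncuts x [set z in Z | P z].
  move=> cP cN.
  have sub0 : [set z in Z0 | P z] \subset [set z in Z | P z].
    by apply/subsetP => z; rewrite !inE -andbA => /and3P[-> _ ->].
  apply: IH.
  - by have := card_split Z P; lia.
  - by move=> x y; rewrite !inE => /andP[xA _] /andP[yZ _]; apply: eE.
  - by rewrite -cP subset_leq_card.
  - rewrite ltnNge; apply/negP => many.
    apply: (efree many (T := [set z in Z0 | P z])); first by rewrite cP.
    move=> x y; rewrite !inE -!andbA => /and3P[xA tx sp] /and3P[yZ qy Py].
    rewrite eE // /three_sided.
    have := forallP sp y; rewrite inE yZ Py /= => /andP[-> ->] /=.
    by rewrite (leq_trans qy) // leqNgt.
have sub0 (P : pred Y) : #|[set z in Z0 | P z]| <= #|[set z in Z | P z]|.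
  by apply/subset_leq_card/subsetP => z; rewrite !inE -andbA => /and3P[-> _ ->].
have pL := pass _ hw; have pR := pass (fun z => ~~ (r z < w)) hw'.
have cL := sub0 (fun z => r z < w); have cR := sub0 (fun z => ~~ (r z < w)).
have {}pL := pL _; have {}pR := pR _.
have {pL}pL : edges e Ap ZL + 2 * s * s <= 4 * s * #|ZL| + 2 * s * \sum_(x in Ap) ncuts x ZL.
  by apply: pL; rewrite /= (leq_trans _ cR) // hw'.
have {pR}pR : edges e Ap ZR + 2 * s * s <= 4 * s * #|ZR| + 2 * s * \sum_(x in Ap) ncuts x ZR.
  apply: pR; rewrite (leq_trans s_gt0) // -hw (leq_trans cL) // subset_leq_card //.
  by apply/subsetP => z; rewrite !inE negbK.
have sumA : \sum_(x in A) ncuts x Z =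
    \sum_(x in At) ncuts x Z + \sum_(x in Ap) ncuts x Z.
  by rewrite (bigID (fun x => top x < v)) /=; congr (_ + _); apply: eq_bigl => x;
    rewrite inE.
have sumP : \sum_(x in Ap) ncuts x ZL + \sum_(x in Ap) ncuts x ZR
    <= \sum_(x in Ap) ncuts x Z.
  by rewrite -big_split /=; apply: leq_sum => x _; apply: ncuts_split.
rewrite sumA (edges_splitl _ _ _ (fun x => top x < v)) -/At -/Ap.
rewrite (edges_splitr _ Ap _ (fun z => r z < w)) -/ZL -/ZR.
rewrite (card_split Z (fun z => r z < w)) -/ZL -/ZR.
nia.
Qed.

(** Three-sided ranges have linearly many incidences, with no logarithm: a
    range either has fewer than [s] neighbours, or it contains the first [s]
    points as soon as it spans [Z], which starts the recursion above. *)
Lemma three_sided_linear (A : {set X}) (Z : {set Y}) :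
  {in A & Z, forall x y, e x y = three_sided x y} ->
  edges e A Z <= 5 * s * (#|A| + #|Z|).
Proof.
move=> eE.
pose deg x := #|[set y in Z | e x y]|.
rewrite (edges_splitl _ _ _ (fun x => deg x < s)).
have low : edges e [set x in A | deg x < s] Z <= #|A| * s.
  rewrite (leq_trans (edges_bound (k := s) _)) //.
    by move=> x; rewrite inE => /andP[_ /ltnW].
  rewrite leq_mul2r; apply/orP; right; apply/subset_leq_card/subsetP => x.
  by rewrite inE => /andP[].
set A' := [set x in A | ~~ (deg x < s)].
have cA' : #|A'| <= #|A|.
  by apply/subset_leq_card/subsetP => x; rewrite inE => /andP[].
case: (ltnP #|Z| s) => [Zs|sZ].
  suff -> : edges e A' Z = 0 by nia.
  apply: edges0 => x y; rewrite !inE => /andP[_ /negP[]].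
  rewrite (leq_ltn_trans _ Zs) // subset_leq_card //.
  by apply/subsetP => z; rewrite inE => /andP[].
have [v hv] := initial_segment qI sZ.
have few : #|[set x in A' | spans x Z]| < s.
  rewrite ltnNge; apply/negP => many.
  apply: (efree many (T := [set z in Z | q z < v])); first by rewrite hv.
  move=> x y; rewrite !inE -andbA => /and3P[xA dx sp] /andP[yZ qy].
  rewrite eE // /three_sided.
  have := forallP sp y; rewrite yZ /= => /andP[-> ->] /=.
  rewrite ltnNge; apply/negP => ty; move/negP: dx; apply.
  rewrite -hv; apply: proper_card; apply/properP; split.
    apply/subsetP => z; rewrite !inE => /andP[zZ]; rewrite eE // zZ => /and3P[_ _ h].
    by rewrite (leq_trans h) // (leq_trans ty) // ltnW.
  exists y; first by rewrite inE yZ.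
  by rewrite inE yZ /= eE // /three_sided [q y < _]ltnNge ty !andbF.
have eE' : {in A' & Z, forall x y, e x y = three_sided x y}.
  by move=> x y; rewrite inE => /andP[xA _]; apply: eE.
have := three_sided_rec eE' sZ few.
have : \sum_(x in A') ncuts x Z <= #|A'| * 2.
  by rewrite -sum_nat_const; apply: leq_sum => x _; rewrite /ncuts; do 2 case: (cuts _ _).
nia.
Qed.

End ThreeSided.

(** * Boxes with integer coordinates *)

Section Boxes.
Variables (X Y : finType) (s : nat) (e : X -> Y -> bool).
Hypotheses (s_gt0 : 0 < s) (efree : biclique_free s e).
Variables (r : nat -> Y -> nat) (lo hi : nat -> X -> nat) (b D : nat).
Hypotheses (rI : forall k, injective (r k)) (rD : forall k y, r k y < b ^ D).
Hypotheses (b_gt0 : 0 < b) (D_gt0 : 0 < D).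
Implicit Types (A : {set X}) (B : {set Y}).

Fixpoint in_box d x y : bool :=
  if d is k.+1 then in_box k x y && (lo k x <= r k y < hi k x) else true.

(** A uniform bound for all subproblems on which the graph is given by the
    first [d] coordinates.  The costs of points and of boxes are kept apart:
    powers of the branching number [b] are affordable only in the cost of a
    box. *)
Definition controlled alpha beta d := forall A B,
  {in A & B, forall x y, e x y = in_box d x y} ->
  edges e A B <= alpha * #|B| + beta * #|A|.

Definition inside o w v := o < v < o + w.

Lemma block_le w i j : i < j -> i * w + w <= j * w.
Proof. by move=> ij; rewrite addnC -mulSn leq_mul2r ij orbT. Qed.

(** The ends of a box are followed down the tree: an end strictly inside a
    slab is strictly inside at most one of its [b] children. *)
Lemma inside_split o w v :
  \sum_(i < b) inside (o + i * w) w v <= inside o (b * w) v.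
Proof.
case: (boolP [exists i : 'I_b, inside (o + i * w) w v]) => [/existsP[i hi0]|no].
  rewrite (bigD1 i) //= big1 ?addn0 => [|i' ne].
    move: hi0 (block_le w (ltn_ord i)); rewrite /inside => hi0 ib.
    have -> : o < v < o + b * w by lia.
    exact: leq_b1.
  apply/eqP; rewrite eqb0; apply: contra ne => hi'; rewrite -val_eqE /=.
  rewrite /inside in hi0 hi'.
  by case: (ltngtP (val i') (val i)) => //= /(block_le w) /= l; lia.
rewrite big1 // => i _; apply/eqP; rewrite eqb0; apply: contra no => h.
by apply/existsP; exists i.
Qed.

Definition slab k o w B := {in B, forall y, o <= r k y < o + w}.

Lemma slab_slice (k o w : nat) B : slab k o (b * w) B ->
  {in B, forall y, (r k y - o) %/ w < b} /\
  (forall i, slab k (o + i * w) w [set y in B | (r k y - o) %/ w == i]).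
Proof.
move=> sB; split.
  move=> y /sB /andP[h1 h2]; rewrite ltn_divLR; [lia|].
  by case: w h2 {sB} => // ; lia.
move=> i y; rewrite inE => /andP[/sB /andP[h1 h2] /eqP <-].
have w0 : 0 < w by case: w h2 {sB} => //; lia.
have := divn_eq (r k y - o) w; have := ltn_pmod (r k y - o) w0; lia.
Qed.

(** One slab of height [j] in the [b]-ary tree over coordinate [d].  In each
    child a box either has no end strictly inside, so that the child falls
    under [d] coordinates or outside the box, or it is passed on together with
    its ends.  A point is charged [alpha] once per level; a box is charged
    [beta] for each of the [b] children of the at most two slabs per level that
    contain one of its ends. *)
Lemma tree_level alpha beta d j o A B :
  controlled alpha beta d ->
  {in A & B, forall x y, e x y = in_box d.+1 x y} ->
  slab d o (b ^ j) B ->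
  {in A, forall x, 0 < inside o (b ^ j) (lo d x) + inside o (b ^ j) (hi d x)} ->
  edges e A B <= j * alpha * #|B| + j * b * beta *
    \sum_(x in A) (inside o (b ^ j) (lo d x) + inside o (b ^ j) (hi d x)).
Proof.
move=> ctrl; elim: j o A B => [|j IH] o A B eE sB cutA.
  rewrite edges0 // => x y xA yB; have := cutA _ xA; rewrite /inside; lia.
rewrite expnS in sB cutA *.
set w := b ^ j in IH sB cutA *.
have [keyb sBi] := slab_slice sB.
pose key y := (r d y - o) %/ w.
rewrite (edges_slice e A keyb) (card_slice keyb).
pose Bi (i : nat) := [set y in B | key y == i].
pose c (i : nat) x := inside (o + i * w) w (lo d x) + inside (o + i * w) w (hi d x).
have step (i : 'I_b) : edges e A (Bi i) <=
    (j.+1 * alpha * #|Bi i| + beta * #|A|) + j * b * beta * \sum_(x in A) c i x.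
  rewrite (edges_splitl _ _ _ (fun x => c i x == 0)).
  (* No end strictly inside the child: box and child are disjoint or nested. *)
  have h0 : edges e [set x in A | c i x == 0] (Bi i) <= alpha * #|Bi i| + beta * #|A|.
    pose F := [set x in A | (c i x == 0) && (lo d x <= o + i * w) && (o + i.+1 * w <= hi d x)].
    have FA : #|F| <= #|A| by apply/subset_leq_card/subsetP => x; rewrite inE => /andP[].
    rewrite (edges_splitl _ _ _ (fun x => (lo d x <= o + i * w) && (o + i.+1 * w <= hi d x))).
    rewrite [X in _ + X]edges0 ?addn0; last first.
      move=> x y; rewrite inE => /andP[]; rewrite inE => /andP[xA cx] nx yB.
      have := sBi i _ yB => ry; move: yB; rewrite inE => /andP[yB _].
      rewrite eE //= negb_and; apply/orP; right; apply/negP => hx.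
      move: cx nx; rewrite /c /inside; lia.
    rewrite (leq_trans (ctrl _ _ _)) //.
      move=> x y; rewrite inE => /andP[]; rewrite inE => /andP[xA cx] nx yB.
      have := sBi i _ yB => ry; move: yB; rewrite inE => /andP[yB _].
      rewrite eE //=; case: (in_box d x y) => //=; lia.
    rewrite leq_add2l leq_mul2l; apply/orP; right; apply/subset_leq_card/subsetP => x.
    by rewrite !inE => /andP[/andP[]].
  have h1 : edges e [set x in A | c i x != 0] (Bi i) <=
      j * alpha * #|Bi i| + j * b * beta * \sum_(x in A) c i x.
    rewrite (leq_trans (IH (o + i * w) _ _ _ (sBi i) _)) //.
    - by move=> x y; rewrite !inE => /andP[xA _] /andP[yB _]; apply: eE.
    - by move=> x; rewrite inE lt0n => /andP[].
    rewrite leq_add2l leq_mul2l; apply/orP; right.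
    rewrite [X in _ <= X](bigID (fun x => c i x != 0)) /=.
    rewrite (leq_trans _ (leq_addr _ _)) //.
    by apply/eq_leq/eq_bigl => x; rewrite inE.
  nia.
apply: leq_trans (leq_sum _ (fun i _ => step i)) _.
rewrite big_split big_split /= -!big_distrr /= sum_nat_const card_ord -addnA leq_add2l.
rewrite exchange_big /=.
have sumc : \sum_(x in A) \sum_(i < b) c i x <=
    \sum_(x in A) (inside o (b * w) (lo d x) + inside o (b * w) (hi d x)).
  by apply: leq_sum => x xA; rewrite big_split leq_add ?inside_split.
have cA : #|A| <= \sum_(x in A) (inside o (b * w) (lo d x) + inside o (b * w) (hi d x)).
  by rewrite -sum1_card; apply: leq_sum => x /cutA.
move: sumc cA; set S1 := \sum_(x in A) \sum_(i < b) _; set S2 := \sum_(x in A) _ => sumc cA.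
have h1 : j * b * beta * S1 <= j * b * beta * S2 by rewrite leq_mul2l sumc orbT.
have h2 : beta * (b * #|A|) <= beta * (b * S2) by rewrite !leq_mul2l cA !orbT.
by rewrite (leq_trans (leq_add h2 h1)) //; apply/eq_leq; nia.
Qed.

(** A further coordinate costs a factor [D] for points and [D * b] for boxes:
    the tree of height [D] over that coordinate, started at the root slab. *)
Lemma controlled_succ alpha beta d : controlled alpha beta d ->
  controlled (2 * D * alpha) (3 * D * b * beta) d.+1.
Proof.
move=> ctrl A B eE.
pose c x := inside 0 (b ^ D) (lo d x) + inside 0 (b ^ D) (hi d x).
have rB y : 0 <= r d y < 0 + b ^ D by rewrite rD.
rewrite (edges_splitl _ _ _ (fun x => c x != 0)).
have h1 : edges e [set x in A | c x != 0] B <= D * alpha * #|B| + D * b * beta * (2 * #|A|).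
  rewrite (leq_trans (tree_level (j := D) (o := 0) ctrl _ _ _)) //.
  - by move=> x y; rewrite inE => /andP[xA _]; apply: eE.
  - by move=> x; rewrite inE lt0n => /andP[].
  rewrite leq_add2l leq_mul2l; apply/orP; right.
  apply: (@leq_trans (\sum_(x in [set x in A | c x != 0]) 2)).
    by apply: leq_sum => x _; do 2 case: (inside _ _ _).
  rewrite sum_nat_const mulnC leq_mul2l /=; apply/subset_leq_card/subsetP => x.
  by rewrite inE => /andP[].
have h0 : edges e [set x in A | ~~ (c x != 0)] B <= alpha * #|B| + beta * #|A|.
  rewrite (edges_splitl _ _ _ (fun x => (lo d x <= 0) && (b ^ D <= hi d x))).
  rewrite [X in _ + X]edges0 ?addn0; last first.
    move=> x y; rewrite inE => /andP[]; rewrite inE => /andP[xA cx] nx yB.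
    rewrite eE //= negb_and; apply/orP; right; apply/negP => hx.
    by have := rB y; move: cx nx; rewrite /c /inside; lia.
  rewrite (leq_trans (ctrl _ _ _)) //.
    move=> x y; rewrite inE => /andP[]; rewrite inE => /andP[xA cx] nx yB.
    by have := rB y; rewrite eE //=; case: (in_box d x y) => //=; lia.
  rewrite leq_add2l leq_mul2l; apply/orP; right; apply/subset_leq_card/subsetP => x.
  by rewrite !inE => /andP[/andP[]].
have : beta * #|A| <= D * b * (beta * #|A|) by rewrite leq_pmull // muln_gt0 D_gt0.
have : alpha * #|B| <= D * (alpha * #|B|) by rewrite leq_pmull.
by nia.
Qed.

(** Intervals on a line are three-sided ranges whose third side repeats the
    upper end. *)
Lemma controlled1 : controlled (5 * s) (5 * s) 1.
Proof.
move=> A B eE.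
rewrite (leq_trans (three_sided_linear s_gt0 efree (r := r 0) (q := r 0)
  (lo := lo 0) (hi := hi 0) (top := hi 0) (@rI 0) (@rI 0) _)) //.
  by move=> x y xA yB; rewrite eE //= /three_sided; case: (_ <= _); case: (_ < _).
by rewrite mulnDr addnC.
Qed.

(** Within a slab, a rectangle without both ends strictly inside is bounded on
    at most one side there, hence three-sided; an upward range is turned into a
    downward one by reversing the order of the points. *)
Lemma half_open A B o w :
  {in A & B, forall x y, e x y = in_box 2 x y} -> slab 1 o w B ->
  {in A, forall x, ~~ (inside o w (lo 1 x) && inside o w (hi 1 x))} ->
  edges e A B <= 10 * s * (#|A| + #|B|).
Proof.
move=> eE sB noA.
have up : edges e [set x in A | lo 1 x <= o] B <= 5 * s * (#|A| + #|B|).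
  rewrite (leq_trans (three_sided_linear s_gt0 efree (r := r 0) (q := r 1)
    (lo := lo 0) (hi := hi 0) (top := hi 1) (@rI 0) (@rI 1) _)) //.
    move=> x y; rewrite inE => /andP[xA lx] yB.
    by have := sB y yB; rewrite eE //= /three_sided; lia.
  rewrite leq_mul2l leq_add2r; apply/orP; right; apply/subset_leq_card/subsetP => x.
  by rewrite inE => /andP[].
have down : edges e [set x in A | ~~ (lo 1 x <= o)] B <= 5 * s * (#|A| + #|B|).
  rewrite (edges_splitl _ _ _ (fun x => o + w <= hi 1 x)) addnC edges0 ?add0n; last first.
    move=> x y; rewrite inE => /andP[]; rewrite inE => /andP[xA lx] hx yB.
    apply/negP; rewrite eE //= => h.
    by have := noA _ xA; have := sB y yB; rewrite /inside; lia.
  rewrite (leq_trans (three_sided_linear s_gt0 efree (r := r 0)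
    (q := fun y => (b ^ D).-1 - r 1 y)
    (lo := lo 0) (hi := hi 0) (top := fun x => b ^ D - lo 1 x) (@rI 0) _ _)) //.
  - by move=> y y' h; apply: (@rI 1); have := rD 1 y; have := rD 1 y'; lia.
  - move=> x y; rewrite inE => /andP[]; rewrite inE => /andP[xA lx] hx yB.
    by have := sB y yB; have := rD 1 y; rewrite eE //= /three_sided; lia.
  rewrite leq_mul2l leq_add2r; apply/orP; right; apply/subset_leq_card/subsetP => x.
  by rewrite !inE => /andP[/andP[]].
rewrite (edges_splitl _ _ _ (fun x => lo 1 x <= o)); nia.
Qed.

(** In the plane a rectangle is charged at a single node of the tree, the one
    where its two ends separate: there it breaks up into three-sided ranges,
    which cost no logarithm.  Boxes thus pay [b] here, in place of the factor
    [D * b] of [tree_level]; the factor [D] saved absorbs the powers of [b] in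
    the end. *)
Lemma plane_level j o A B :
  {in A & B, forall x y, e x y = in_box 2 x y} -> slab 1 o (b ^ j) B ->
  {in A, forall x, inside o (b ^ j) (lo 1 x) && inside o (b ^ j) (hi 1 x)} ->
  edges e A B <= 10 * s * (j * #|B| + b * #|A|).
Proof.
elim: j o A B => [|j IH] o A B eE sB inA.
  rewrite edges0 // => x y xA yB; have := inA _ xA; rewrite /inside; lia.
rewrite expnS in sB inA *.
set w := b ^ j in IH sB inA *.
have [keyb sBi] := slab_slice sB.
pose key y := (r 1 y - o) %/ w.
rewrite (edges_slice e A keyb) (card_slice keyb).
pose Bi (i : nat) := [set y in B | key y == i].
pose c (i : nat) x := inside (o + i * w) w (lo 1 x) && inside (o + i * w) w (hi 1 x).
(* The rectangles whose ends separate at this node. *)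
pose A' := [set x in A | ~~ [exists i : 'I_b, c i x]].
have step (i : 'I_b) : edges e A (Bi i) <=
    10 * s * (j.+1 * #|Bi i| + b * #|[set x in A | c i x]| + #|A'|).
  have eEi : {in A & Bi i, forall x y, e x y = in_box 2 x y}.
    by move=> x y xA; rewrite inE => /andP[yB _]; apply: eE.
  rewrite (edges_splitl _ _ _ (c i)).
  have h1 : edges e [set x in A | c i x] (Bi i) <=
      10 * s * (j * #|Bi i| + b * #|[set x in A | c i x]|).
    apply: (IH (o + i * w)); [ | exact: sBi | ].
      by move=> x y; rewrite inE => /andP[xA _]; apply: eEi.
    by move=> x; rewrite inE => /andP[].
  have h0 : edges e [set x in A | ~~ c i x] (Bi i) <= 10 * s * (#|A'| + #|Bi i|).
    rewrite (edges_splitl _ _ _ (fun x => ~~ [exists i : 'I_b, c i x])).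
    rewrite [X in _ + X]edges0 ?addn0; last first.
      move=> x y; rewrite inE => /andP[]; rewrite inE => /andP[xA ncx].
      rewrite negbK => /existsP[i' ci'] yB; rewrite eEi //; apply/negP => /= h.
      have ry := sBi i _ yB.
      have ne : val i != val i' by apply: contraNneq ncx => ->.
      move: ci' ne; rewrite /c /inside /= => ci'.
      by case: (ltngtP (val i) (val i')) => //= /(block_le w) /= l _; lia.
    rewrite (leq_trans (half_open (o := o + i * w) (w := w) _ (sBi i) _)) //.
    - move=> x y; rewrite inE => /andP[]; rewrite inE => /andP[xA _] _.
      exact: eEi.
    - by move=> x; rewrite inE => /andP[]; rewrite inE => /andP[_ ].
    rewrite leq_mul2l leq_add2r; apply/orP; right; apply/subset_leq_card/subsetP => x.
    by rewrite !inE => /andP[/andP[-> _] ->].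
  nia.
apply: leq_trans (leq_sum _ (fun i _ => step i)) _.
rewrite -big_distrr /= !big_split /= -!big_distrr /= sum_nat_const card_ord.
rewrite leq_mul2l -addnA leq_add2l -mulnDr leq_mul2l.
suff -> : \sum_(i < b) #|[set x in A | c i x]| + #|A'| <= #|A| by rewrite !orbT.
rewrite addnC (card_split A (fun x => ~~ [exists i : 'I_b, c i x])) leq_add2l.
rewrite (eq_bigr (fun i : 'I_b => \sum_(x in A) c i x)); last first.
  move=> i _; rewrite -sum1_card big_mkcond [RHS]big_mkcond /=.
  by apply: eq_bigr => x _; rewrite inE; case: (x \in A); case: (c i x).
rewrite exchange_big /= -sum1_card big_mkcond [X in _ <= X]big_mkcond /=.
apply: leq_sum => x _; rewrite inE negbK; case xA: (x \in A) => //=.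
case: ifP => [_|no].
  apply: (@leq_trans (\sum_(i < b) inside (o + i * w) w (lo 1 x))).
    by apply: leq_sum => i _; rewrite /c; do 2 case: (inside _ _ _).
  by rewrite (leq_trans (inside_split _ _ _)) // leq_b1.
rewrite big1 // => i _; apply/eqP; rewrite eqb0; apply/negP => ci.
by move/negbT/existsP: no; apply; exists i.
Qed.

Lemma controlled2 : controlled (20 * s * D) (20 * s * b) 2.
Proof.
move=> A B eE.
pose c x := inside 0 (b ^ D) (lo 1 x) && inside 0 (b ^ D) (hi 1 x).
have sB : slab 1 0 (b ^ D) B by move=> y _; rewrite rD.
rewrite (edges_splitl _ _ _ c).
have sub (P : pred X) : #|[set x in A | P x]| <= #|A|.
  by apply/subset_leq_card/subsetP => x; rewrite inE => /andP[].
have h1 : edges e [set x in A | c x] B <= 10 * s * (D * #|B| + b * #|[set x in A | c x]|).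
  apply: (plane_level (o := 0)) => //.
    by move=> x y; rewrite inE => /andP[xA _]; apply: eE.
  by move=> x; rewrite inE => /andP[].
have h0 : edges e [set x in A | ~~ c x] B <= 10 * s * (#|[set x in A | ~~ c x]| + #|B|).
  apply: (half_open (o := 0) (w := b ^ D)) => //.
    by move=> x y; rewrite inE => /andP[xA _]; apply: eE.
  by move=> x; rewrite inE => /andP[].
have := sub c; have := sub (fun x => ~~ c x).
have : #|B| <= D * #|B| by rewrite leq_pmull.
have : #|A| <= b * #|A| by rewrite leq_pmull.
have : b * #|[set x in A | c x]| <= b * #|A| by rewrite leq_mul2l sub orbT.
nia.
Qed.

(** Starting the induction in the plane rather than on the line saves one factor
    [D] in the cost of a box. *)
Lemma controlledP d : controlled (20 * s * (3 * D) ^ d.+1)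
  (20 * s * (3 ^ d.+1 * D ^ d * b ^ d.+1)) d.+2.
Proof.
elim: d => [|d IH].
  move=> A B eE; rewrite (leq_trans (controlled2 eE)) //.
  by rewrite !expn1 expn0 leq_add // leq_mul2r; apply/orP; right; nia.
move=> A B eE; rewrite (leq_trans (controlled_succ IH eE)) // leq_add // leq_mul2r;
  apply/orP; right.
  rewrite [in leqRHS]expnS; set Q := (3 * D) ^ _; nia.
rewrite [in leqRHS](expnS 3 d.+1) [in leqRHS](expnS D) [in leqRHS](expnS b d.+1).
set Q1 := 3 ^ _; set Q2 := D ^ _; set Q3 := b ^ _.
by apply/eq_leq; lia.
Qed.

End Boxes.

Local Open Scope ring_scope.

(** * Covering polyhedra by parallelotopes *)

Section Cover.
Variables (R : realFieldType) (X : Type).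
Local Notation T := (nat -> R).
Implicit Types (f g : T -> R) (m : nat -> T -> R) (F : X -> T -> Prop).

Definition linear_form d f := exists a : nat -> R, forall y, f y = \sum_(k < d) a k * y k.

Lemma linD d f g : linear_form d f -> linear_form d g -> linear_form d (fun y => f y + g y).
Proof.
move=> [a fE] [b gE]; exists (fun k => a k + b k) => y.
by rewrite fE gE -big_split; apply: eq_bigr => k _; rewrite mulrDl.
Qed.

Lemma linZ d c f : linear_form d f -> linear_form d (fun y => c * f y).
Proof.
move=> [a fE]; exists (fun k => c * a k) => y.
by rewrite fE big_distrr; apply: eq_bigr => k _; rewrite /= mulrA.
Qed.

Lemma lin0 d : linear_form d (fun=> 0).
Proof. by exists (fun=> 0) => y; rewrite big1 // => k _; rewrite mul0r. Qed.

Lemma lin_eq d f g : (forall y, f y = g y) -> linear_form d f -> linear_form d g.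
Proof. by move=> fg [a fE]; exists a => y; rewrite -fg. Qed.

Lemma lin_sum d n (c : nat -> R) m :
  (forall k, (k < n)%N -> linear_form d (m k)) -> linear_form d (fun y => \sum_(k < n) c k * m k y).
Proof.
elim: n => [|n IH] lm.
  by apply: lin_eq (lin0 d) => y; rewrite big_ord0.
apply: lin_eq (linD (IH _) (linZ (c n) (lm n _))) => // [y|k kn].
  by rewrite big_ord_recr.
by apply: lm; rewrite leqW.
Qed.

Lemma lin_succ d f : linear_form d f -> linear_form d.+1 f.
Proof.
move=> [a fE]; exists (fun k => if (k < d)%N then a k else 0) => y.
rewrite big_ord_recr /= ltnn mul0r addr0 fE.
by apply: eq_bigr => k _; rewrite ltn_ord.
Qed.

Lemma lin_coord d k : (k < d)%N -> linear_form d (fun y => y k).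
Proof.
move=> kd; exists (fun i => (i == k)%:R) => y.
rewrite (bigD1 (Ordinal kd)) //= eqxx mul1r big1 ?addr0 // => i ne.
by rewrite -val_eqE /= in ne; rewrite (negbTE ne) mul0r.
Qed.

Lemma lin_local d f : linear_form d f ->
  forall y y', (forall k, (k < d)%N -> y k = y' k) -> f y = f y'.
Proof.
by move=> [a fE] y y' yy'; rewrite !fE; apply: eq_bigr => k _; rewrite yy'.
Qed.

(** Linear coordinates on [R^d]: points are sequences of which only the first
    [d] entries matter, and the forms [m 0, ..., m (d - 1)] are onto and span
    all linear forms. *)
Definition frame d m :=
  [/\ forall k, (k < d)%N -> linear_form d (m k),
      forall v : nat -> R, exists y, forall k, (k < d)%N -> m k y = v k &
      forall f, linear_form d f ->
        exists c : nat -> R, forall y, f y = \sum_(k < d) c k * m k y].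

Definition subst_form m j g : nat -> T -> R := fun k => if k == j then g else m k.

Lemma frame_replace d m j (c : nat -> R) g : frame d m -> (j < d)%N -> c j != 0 ->
  (forall y, g y = \sum_(k < d) c k * m k y) -> frame d (subst_form m j g).
Proof.
move=> [ml ms mg] jd cj gE; rewrite /subst_form.
have gE' y : g y = c j * m j y + \sum_(k < d | k != Ordinal jd) c k * m k y.
  by rewrite gE (bigD1 (Ordinal jd)).
have off (k : 'I_d) : k != Ordinal jd -> (val k == j) = false by move/negbTE.
split.
- move=> k kd; case: eqP => _; last exact: ml.
  by apply: lin_eq (lin_sum c ml) => y; rewrite gE.
- move=> v.
  have [y yE] := ms (fun k => if k == j then
     (v j - \sum_(k < d | k != Ordinal jd) c k * v k) / c j else v k).
  exists y => k kd; case: (eqVneq k j) => [->|kj]; last by rewrite yE // (negbTE kj).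
  rewrite gE' yE // eqxx mulrC divfK //.
  rewrite [X in _ + X](eq_bigr (fun k : 'I_d => c k * v k)) ?subrK // => i ij.
  by rewrite yE // off.
- move=> f /mg[b fE].
  exists (fun k => if k == j then b j / c j else b k - b j / c j * c k) => y.
  rewrite (bigD1 (Ordinal jd)) //= eqxx gE' fE (bigD1 (Ordinal jd)) //=.
  rewrite [X in _ = _ + X](eq_bigr (fun k : 'I_d =>
    b k * m k y - b j / c j * (c k * m k y))); last first.
    by move=> k kj; rewrite off // mulrBl mulrA.
  rewrite sumrB -mulr_sumr mulrDr [b j / c j * (c j * _)]mulrA divfK //.
  by rewrite -!addrA; congr (_ + _); rewrite addrC subrK.
Qed.

Lemma frame0 m : frame 0 m.
Proof.
split=> // [v|f [a fE]]; first by exists v.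
by exists a => y; rewrite fE !big_ord0.
Qed.

Lemma frame_shear d m g : frame d m -> linear_form d g ->
  frame d.+1 (subst_form m d (fun y => y d - g y)).
Proof.
move=> [ml ms mg] lg; rewrite /subst_form; split.
- move=> k; rewrite ltnS leq_eqVlt; case: eqP => [_ _|_ /= kd]; last exact/lin_succ/ml.
  have := linD (lin_coord (ltnSn d)) (linZ (-1) (lin_succ lg)).
  by apply: lin_eq => y; rewrite mulN1r.
- move=> v; have [y yE] := ms v.
  have loc k : (k < d)%N -> y k = (if k == d then v d + g y else y k).
    by move=> kd; rewrite ltn_eqF.
  exists (fun k => if k == d then v d + g y else y k) => k.
  rewrite ltnS leq_eqVlt; case: eqP => [-> _|_ /= kd].
    by rewrite eqxx -(lin_local lg loc) addrK.
  by rewrite -(lin_local (ml k kd) loc) yE.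
- move=> f [a fE].
  have lf : linear_form d (fun y => \sum_(k < d) a k * y k + a d * g y).
    by apply: linD (linZ _ lg); exists a.
  have [c cE] := mg _ lf.
  exists (fun k => if k == d then a d else c k) => y.
  rewrite big_ord_recr /= eqxx fE big_ord_recr /=.
  rewrite [X in _ = X + _](eq_bigr (fun k : 'I_d => c k * m k y)) => [|k _]; last by rewrite /= ltn_eqF ?ltn_ord.
  by rewrite -cE; ring.
Qed.

Lemma sum_two d k (a b : R) (u : nat -> R) : (k < d)%N ->
  \sum_(i < d.+1) (if i == k :> nat then a else if i == d :> nat then b else 0) * u i
    = a * u k + b * u d.
Proof.
move=> kd; rewrite big_ord_recr /= [X in _ + X](_ : _ = b * u d); last first.
  by rewrite eqxx gtn_eqF.
congr (_ + _); rewrite (bigD1 (Ordinal kd)) //= eqxx big1 ?addr0 // => i ik.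
have -> : (val i == k) = false by move/negbTE: ik.
by rewrite ltn_eqF // mul0r.
Qed.

(** A family of parallelotopes, indexed by [x], whose directions do not depend
    on [x]. *)
Definition box_family d F := exists m (on : X -> Prop) (lo hi : X -> nat -> R),
  frame d m /\
  forall x y, F x y <-> on x /\ forall k, (k < d)%N -> lo x k <= m k y <= hi x k.

(** [box_cover d N F]: the relation [F] is a union of at most [N] families of
    parallelotopes.  The families overlap in general. *)
Inductive box_cover d : nat -> (X -> T -> Prop) -> Prop :=
| cover_none N F : (forall x y, ~ F x y) -> box_cover d N F
| cover_box N F : (0 < N)%N -> box_family d F -> box_cover d N F
| cover_or N1 N2 N F1 F2 F : box_cover d N1 F1 -> box_cover d N2 F2 -> (N1 + N2 <= N)%N ->
    (forall x y, F x y <-> F1 x y \/ F2 x y) -> box_cover d N F.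

Lemma cover_iff d N N' F F' : box_cover d N F -> (N <= N')%N ->
  (forall x y, F' x y <-> F x y) -> box_cover d N' F'.
Proof.
move=> cF NN FF.
have c0 : box_cover d 0 (fun _ _ => False) by apply: cover_none => x y [].
apply: cover_or cF c0 _ _; first by rewrite addn0.
by move=> x y; rewrite FF; tauto.
Qed.

Lemma cover_exists d N (I : finType) (F : I -> X -> T -> Prop) :
  (forall i, box_cover d N (F i)) -> box_cover d (#|I| * N) (fun x y => exists i, F i x y).
Proof.
move=> cF.
suff main (s : seq I) : box_cover d (size s * N) (fun x y => exists2 i, i \in s & F i x y).
  apply: cover_iff (main (enum I)) _ _; first by rewrite cardE.
  by move=> x y; split => [[i ?]|[i _ ?]]; exists i; rewrite ?mem_enum.
elim: s => [|i s IH]; first by apply: cover_none => x y [].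
apply: cover_or (cF i) IH _ _; first by rewrite mulSn.
move=> x y; split => [[j]|[Fi|[j js Fj]]].
- by rewrite inE => /orP[/eqP -> |js] Fj; [left|right; exists j].
- by exists i; rewrite ?mem_head.
- by exists j; rewrite // inE js orbT.
Qed.

Lemma first_exceed n (t : nat -> R) S z :
  z <= S + \sum_(i < n) t i -> z <= S \/ exists2 k, (k < n)%N &
    S + \sum_(i < k) t i < z <= S + \sum_(i < k) t i + t k.
Proof.
elim: n => [|n IH]; first by rewrite big_ord0 addr0; left.
rewrite big_ord_recr /= addrA => h.
case: (lerP z (S + \sum_(i < n) t i)) => [/IH [|[k kn hk]]|lt].
- by left.
- by right; exists k => //; rewrite ltnW.
- by right; exists n; rewrite ?lt.
Qed.

(** The region between the graphs of two affine functions over a box [lo <= m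
    <= hi].  After the shear [z = y d - g2 y], it is [q0 <= z <= S0 + t 0 + ...
    + t (d - 1)], where [t k] runs over the interval from [0] to [wd k] and [S0]
    is the height of the upper graph at its lowest corner [v].  Above [S0], let
    [k] be first with [z <= S0 + t 0 + ... + t k]; subtracting the partial sum
    from [z] leaves a triangle [0 <= z' <= t k <= wd k] in two coordinates and
    an interval in each of the others.  On the triangle, [z'],
    [t k - z'] and [wd k - t k] are nonnegative with sum [wd k], so two of them
    are at most [wd k / 2]: it is the union of the three parallelograms on which
    a given two of them lie between [0] and [wd k / 2]. *)
Section LiftBox.
Variables (d : nat) (m : nat -> T -> R) (on : X -> Prop) (lo hi : X -> nat -> R).
Hypothesis (fm : frame d m).
Variables (g1 g2 : T -> R) (p0 q0 : X -> R) (c : nat -> R).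
Hypothesis lg2 : linear_form d g2.
Hypothesis cE : forall y, g1 y - g2 y = \sum_(k < d) c k * m k y.

Let inb x y := on x /\ forall k, (k < d)%N -> lo x k <= m k y <= hi x k.
Let inb' k0 x y := on x /\ forall k, (k < d)%N -> k != k0 -> lo x k <= m k y <= hi x k.
Hypothesis inb_le : forall x y, inb x y -> q0 x + g2 y <= p0 x + g1 y.

Let v x k := if 0 <= c k then lo x k else hi x k.
Let mu x k := c k * v x k.
Let wd x k := if 0 <= c k then c k * (hi x k - lo x k) else c k * (lo x k - hi x k).
Let t k x y := c k * m k y - mu x k.
Let S0 x := p0 x + \sum_(k < d) mu x k.
Let zk k y := y d - (g2 y + \sum_(i < k) c i * m i y).
Let o k x := S0 x - \sum_(i < k) mu x i.

Lemma rise_range k x y : lo x k <= m k y <= hi x k -> 0 <= t k x y <= wd x k.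
Proof.
rewrite /t /mu /wd /v; case: (lerP 0 (c k)) => ck /andP[h1 h2].
  have e1 : 0 <= c k * (m k y - lo x k) by rewrite mulr_ge0 // subr_ge0.
  have e2 : 0 <= c k * (hi x k - m k y) by rewrite mulr_ge0 // subr_ge0.
  by lra.
have e1 : 0 <= - c k * (m k y - lo x k) by rewrite mulr_ge0 ?subr_ge0 // oppr_ge0 ltW.
have e2 : 0 <= - c k * (hi x k - m k y) by rewrite mulr_ge0 ?subr_ge0 // oppr_ge0 ltW.
by lra.
Qed.

Lemma rise_rangeV k x y : c k != 0 -> 0 <= t k x y <= wd x k -> lo x k <= m k y <= hi x k.
Proof.
rewrite /t /mu /wd /v; case: (ltgtP 0 (c k)) => // ck _ h.
  rewrite -(ler_pM2l ck) -[m k y <= _](ler_pM2l ck); lra.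
rewrite -(ler_nM2l ck) -[m k y <= _](ler_nM2l ck); lra.
Qed.

(** The corner is a point of [R^d], as the forms [m] are onto, so the lower
    graph lies below the upper one there too. *)
Lemma corner_le x y : inb x y -> q0 x <= S0 x.
Proof.
move=> [onx bx]; have [ml ms mg] := fm; have [y' y'E] := ms (v x).
have iny' : inb x y'.
  split=> // k kd; rewrite y'E // /v; have := bx k kd.
  by case: (0 <= c k); lra.
have := inb_le iny'; have := cE y'.
rewrite (eq_bigr (fun k : 'I_d => mu x k)) => [|k _]; last by rewrite y'E.
by rewrite /S0; lra.
Qed.

Lemma height_le x y : p0 x + g1 y - g2 y = S0 x + \sum_(k < d) t k x y.
Proof. by rewrite -addrA cE /S0 /t sumrB; ring. Qed.

Lemma zkE k x y : zk k y - o k x = (y d - g2 y) - (S0 x + \sum_(i < k) t i x y).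
Proof. by rewrite /zk /o /t sumrB; ring. Qed.

Definition piece k x y :=
  [/\ inb' k x y, 0 <= zk k y - o k x, 0 <= t k x y - (zk k y - o k x) &
      0 <= wd x k - t k x y].

Definition target x y := inb x y /\ q0 x + g2 y <= y d <= p0 x + g1 y.

Lemma targetP x y : target x y <->
  (inb x y /\ q0 x <= y d - g2 y <= S0 x) \/
  (exists k : 'I_d, c k != 0 /\ piece k x y).
Proof.
split.
- move=> [inx /andP[h1 h2]].
  have := @first_exceed d (fun k => t k x y) (S0 x) (y d - g2 y).
  rewrite -height_le => /(_ _)[|h|[k kd h]]; first by lra.
    by left; split=> //; lra.
  right; exists (Ordinal kd); have [onx bx] := inx; rewrite /= in h.
  have tk := rise_range (bx k kd); split=> /=.
    by apply: contraTneq h => ck; rewrite /t /mu ck !mul0r; lra.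
  by split=> /=; [by split=> // i id _; apply: bx | rewrite ?zkE; lra..].
- case=> [[inx h]|[k [ck [[onx bx] ha hb hc]]]].
    split=> //; have := height_le x y.
    have : 0 <= \sum_(k < d) t k x y.
      apply: sumr_ge0 => k _; have [_ bx] := inx.
      by case/andP: (rise_range (bx k (ltn_ord k))).
    by lra.
  have bxk : lo x k <= m k y <= hi x k by apply: rise_rangeV => //; lra.
  have inx : inb x y.
    by split=> // i id; case: (eqVneq i k) => [->//|]; apply: bx.
  split=> //; have := corner_le inx; have := height_le x y.
  have t0 (i : 'I_d) : 0 <= t i x y.
    by have [_ b] := inx; case/andP: (rise_range (b i (ltn_ord i))).
  have s1 : 0 <= \sum_(i < k) t i x y.
    by apply: sumr_ge0 => i _; apply: (t0 (widen_ord (ltnW (ltn_ord k)) i)).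
  have s2 : \sum_(i < k) t i x y + t k x y <= \sum_(i < d) t i x y.
    have := @big_ord_recr _ 0 +%R k (fun i => t i x y) => <-.
    rewrite (big_ord_widen _ (fun i => t i x y) (ltn_ord k)) [leRHS](bigID (fun i : 'I_d => (i < k.+1)%N)) /=.
    by rewrite lerDl sumr_ge0.
  by rewrite zkE in ha hb; lra.
Qed.

Lemma box_two k P Q (lP uP lQ uQ : X -> R) : (k < d)%N ->
  frame d.+1 (subst_form (subst_form m d Q) k P) ->
  box_family d.+1 (fun x y => [/\ inb' k x y, lP x <= P y <= uP x & lQ x <= Q y <= uQ x]).
Proof.
move=> kd fr; exists (subst_form (subst_form m d Q) k P), on,
  (fun x i => if i == k then lP x else if i == d then lQ x else lo x i),
  (fun x i => if i == k then uP x else if i == d then uQ x else hi x i).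
split=> // x y; rewrite /subst_form; split.
  move=> [[onx bx] hP hQ]; split=> // i; rewrite ltnS leq_eqVlt.
  by case: (eqVneq i k) => // ik; case: eqP => //= _ id; apply: bx.
move=> [onx bx]; split.
- by split=> // i id ik; have := bx i (ltnW id); rewrite (negbTE ik) ltn_eqF.
- by have := bx k (ltnW kd); rewrite eqxx.
- by have := bx d (ltnSn d); rewrite eqxx gtn_eqF.
Qed.

Lemma lin_zk k : (k <= d)%N -> linear_form d (fun y => g2 y + \sum_(i < k) c i * m i y).
Proof.
move=> kd; have [ml _ _] := fm; apply: linD lg2 (lin_sum c _) => i ik.
exact/ml/(leq_trans ik).
Qed.

(** The form [zk k] completes [m] to coordinates of [R^(d + 1)], and any
    invertible change of the pair [m k], [zk k] preserves this. *)
Lemma frame_two k (a b a' b' : R) : (k < d)%N -> a != 0 -> a * b' - b * a' != 0 ->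
  frame d.+1 (subst_form (subst_form m d (fun y => a' * m k y + b' * zk k y)) k
     (fun y => a * m k y + b * zk k y)).
Proof.
move=> kd a0 det.
have fz := frame_shear fm (lin_zk (ltnW kd)).
have f1 : frame d.+1 (subst_form (subst_form m d (zk k)) k
    (fun y => a * m k y + b * zk k y)).
  apply: (frame_replace (c := fun i => if i == k then a else if i == d then b else 0) fz).
  - exact: ltnW.
  - by rewrite eqxx.
  - by move=> y; rewrite /= (sum_two _ _ (fun i => subst_form m d (zk k) i y)) // /subst_form eqxx ltn_eqF.
have f2 : frame d.+1 (subst_form (subst_form (subst_form m d (zk k)) k
    (fun y => a * m k y + b * zk k y)) d (fun y => a' * m k y + b' * zk k y)).
  apply: (frame_replace (c := fun i => if i == k then a' / a
    else if i == d then b' - b * a' / a else 0) f1) => //.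
  - rewrite gtn_eqF // eqxx.
    have -> : b' - b * a' / a = (a * b' - b * a') / a by field.
    by rewrite mulf_neq0 ?invr_eq0.
  - move=> y; rewrite /= (sum_two _ _ (fun i => subst_form (subst_form m d (zk k)) k
      (fun y => a * m k y + b * zk k y) i y)) // /subst_form eqxx gtn_eqF // eqxx.
    by field.
have sw i : subst_form (subst_form (subst_form m d (zk k)) k
     (fun y => a * m k y + b * zk k y)) d (fun y => a' * m k y + b' * zk k y) i =
   subst_form (subst_form m d (fun y => a' * m k y + b' * zk k y)) k
     (fun y => a * m k y + b * zk k y) i.
  by rewrite /subst_form; case: (eqVneq i d) => // ->; rewrite gtn_eqF.
have [l u g] := f2; split.
- by move=> i id; rewrite -sw; apply: l.
- by move=> w; have [y yE] := u w; exists y => i id; rewrite -sw yE.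
- move=> f /g [b0 fE]; exists b0 => y; rewrite fE; apply: eq_bigr => i _.
  by rewrite sw.
Qed.

Lemma cover_target : box_cover d.+1 (3 * d + 1) target.
Proof.
apply: (@cover_or _ 1 (d * 3) _ (fun x y => inb x y /\ q0 x <= y d - g2 y <= S0 x)
  (fun x y => exists k : 'I_d, c k != 0 /\ piece k x y)).
- apply: cover_box => //.
  exists (subst_form m d (fun y => y d - g2 y)), on,
    (fun x i => if i == d then q0 x else lo x i),
    (fun x i => if i == d then S0 x else hi x i).
  split; first exact: frame_shear.
  move=> x y; rewrite /subst_form; split.
    move=> [[onx bx] h]; split=> // k; rewrite ltnS leq_eqVlt.
    by case: eqP => //= _; apply: bx.
  move=> [onx bx]; split; last by have := bx d (ltnSn d); rewrite eqxx.
  by split=> // k kd; have := bx k (ltnW kd); rewrite ltn_eqF.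
- rewrite -[X in (X * 3)%N]card_ord; apply: cover_exists => k.
  (* If c k = 0 then t k = 0 and the partial sums do not pass z at k. *)
  case: (eqVneq (c k) 0) => [ck|ck]; first by apply: cover_none => x y [].
  have kd := ltn_ord k.
  pose ab x y := [/\ inb' k x y,
     mu x k - o k x <= c k * m k y + -1 * zk k y <= mu x k - o k x + wd x k / 2 &
     o k x <= 0 * m k y + 1 * zk k y <= o k x + wd x k / 2].
  pose ac x y := [/\ inb' k x y,
     mu x k + wd x k / 2 <= c k * m k y + 0 * zk k y <= mu x k + wd x k &
     o k x <= 0 * m k y + 1 * zk k y <= o k x + wd x k / 2].
  pose bc x y := [/\ inb' k x y,
     mu x k + wd x k / 2 <= c k * m k y + 0 * zk k y <= mu x k + wd x k &
     mu x k - o k x <= c k * m k y + -1 * zk k y <= mu x k - o k x + wd x k / 2].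
  have cab : box_cover d.+1 1 ab.
    by apply: cover_box => //; apply: box_two => //; apply: frame_two => //; rewrite mulr1 mulr0 subr0.
  have cac : box_cover d.+1 1 ac.
    by apply: cover_box => //; apply: box_two => //; apply: frame_two => //; rewrite mulr1 mulr0 subr0.
  have cbc : box_cover d.+1 1 bc.
    by apply: cover_box => //; apply: box_two => //; apply: frame_two => //;
      rewrite mul0r subr0 mulrN1 oppr_eq0.
  have cabc : box_cover d.+1 2 (fun x y => ab x y \/ ac x y).
    exact: cover_or cab cac _ _.
  apply: cover_or cabc cbc _ _ => // x y; rewrite /piece /ab /ac /bc /t.
  split=> [[_ [bx ha hb hc]]|].
    case: (lerP (zk k y - o k x) (wd x k / 2)) => h1; last by right; split=> //; lra.
    case: (lerP (c k * m k y - mu x k - (zk k y - o k x)) (wd x k / 2)) => h2;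
      left; [left|right]; split=> //; lra.
  by case=> [[]|] [bx h1 h2]; split=> //; split=> //; lra.
- by lia.
- exact: targetP.
Qed.

End LiftBox.

Lemma cover_lift d N F g1 g2 (p0 q0 : X -> R) : box_cover d N F -> linear_form d g1 -> linear_form d g2 ->
  (forall x y, F x y -> q0 x + g2 y <= p0 x + g1 y) ->
  box_cover d.+1 (N * (3 * d + 1)) (fun x y => F x y /\ q0 x + g2 y <= y d <= p0 x + g1 y).
Proof.
move=> cF l1 l2; elim: cF => {N F} [N F no|N F N0 bF|N1 N2 N F1 F2 F _ IH1 _ IH2 leN FE] le.
- by apply: cover_none => x y [/no].
- case: bF => m [on [lo [hi [fm FE]]]].
  have [_ _ mg] := fm.
  have [c cE] := mg _ (linD l1 (linZ (-1) l2)).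
  apply: cover_iff (@cover_target d m on lo hi fm g1 g2 p0 q0 c l2 _ _) _ _.
  + by move=> y; rewrite -cE mulN1r.
  + by move=> x y /FE /le.
  + by rewrite leq_pmull.
  + by move=> x y; rewrite FE.
- apply: cover_or (IH1 _) (IH2 _) _ _.
  + by move=> x y F1x; apply: le; rewrite FE; left.
  + by move=> x y F2x; apply: le; rewrite FE; right.
  + by rewrite -mulnDl leq_mul2r leN orbT.
  + by move=> x y; rewrite FE; tauto.
Qed.

(** Only the dimension and the number of constraints enter; the value comes
    from the recursion in [polyhedron_cover]. *)
Fixpoint cover_number d h : nat :=
  if d is k.+1 then (h.+1 * h.+1 * (cover_number k (3 * h.+1) * (3 * k + 1)))%N else 1%N.

(** Fourier-Motzkin elimination of the last coordinate.  Each constraint bounds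
    [y d] from above, from below, or not at all, according to the sign of its
    last coefficient.  Choosing which upper and which lower bound is the
    tightest splits the polyhedron into boundedly many pieces, each of them the
    region between two graphs over a polyhedron of one dimension less, to which
    [cover_lift] applies.  The truncation at [M] provides the bounds that may be
    missing. *)
Theorem polyhedron_cover d (I : finType) (l : I -> T -> R) (u : I -> X -> R) (M : R) :
  (forall i, linear_form d (l i)) ->
  box_cover d (cover_number d #|I|)
    (fun x y => (forall i, l i y <= u i x) /\ forall k, (k < d)%N -> `|y k| <= M).
Proof.
elim: d I l u => [|d IH] I l u linl.
  have l0 i y : l i y = 0 by have [a ->] := linl i; rewrite big_ord0.
  apply: cover_box => //.
  exists (fun _ _ => 0), (fun x => forall i, 0 <= u i x), (fun _ _ => 0), (fun _ _ => 0).
  split; first exact: frame0.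
  by move=> x y; split=> [[h _]|[h _]]; split=> // i; have := h i; rewrite l0.
have [a aE] := fin_all_exists linl.
pose sl i := a i d; pose l' i (y : T) := \sum_(k < d) a i k * y k.
have lE i y : l i y = l' i y + sl i * y d by rewrite aE big_ord_recr.
have linl' i : linear_form d (l' i) by exists (a i).
(* p0 o x + gp o y and q0 o x + gq o y are the upper and lower bounds on y d
   given by constraint o; None, and constraints of the other sign, stand for
   the truncation at M or - M. *)
pose p0 o x := if o is Some i then if 0 < sl i then u i x / sl i else M else M.
pose gp o (y : T) : R := if o is Some i then if 0 < sl i then - (sl i)^-1 * l' i y else 0 else 0.
pose q0 o x := if o is Some i then if sl i < 0 then u i x / sl i else - M else - M.
pose gq o (y : T) : R := if o is Some i then if sl i < 0 then - (sl i)^-1 * l' i y else 0 else 0.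
have lingp o : linear_form d (gp o).
  by case: o => [i|] /=; rewrite /gp; [case: (0 < sl i)|]; [exact: linZ|exact: lin0..].
have lingq o : linear_form d (gq o).
  by case: o => [i|] /=; rewrite /gq; [case: (sl i < 0)|]; [exact: linZ|exact: lin0..].
pose z i (y : T) : R := if sl i == 0 then l' i y else 0.
pose w i x := if sl i == 0 then u i x else 0.
have linz i : linear_form d (z i) by rewrite /z; case: (sl i == 0); [exact: linl'|exact: lin0].
have consE i x y : `|y d| <= M -> (l i y <= u i x) <->
    [/\ y d <= p0 (Some i) x + gp (Some i) y, q0 (Some i) x + gq (Some i) y <= y d &
        z i y <= w i x].
  rewrite ler_norml => /andP[M1 M2]; rewrite lE /p0 /gp /q0 /gq /z /w.
  have e : u i x / sl i + - (sl i)^-1 * l' i y = (u i x - l' i y) / sl i by ring.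
  case: (ltgtP 0 (sl i)) => sg; rewrite ?addr0.
  - rewrite e ler_pdivlMr //; split=> [h|[h _ _]]; last by lra.
    by split=> //; lra.
  - rewrite e ler_ndivrMr //; split=> [h|[_ h _]]; last by lra.
    by split=> //; lra.
  - by rewrite -sg mul0r addr0; split=> [h|[]//]; split.
(* The constraints of a piece (i, j): bound i is the least upper one, bound j
   the greatest lower one, bound j is below bound i, and the constraints
   without y d persist. *)
pose J : finType := (option I + option I + option I)%type.
pose L (ij : option I * option I) (k : J) y := match k with
  | inl (inl k) => gp ij.1 y + -1 * gp k y
  | inl (inr k) => gq k y + -1 * gq ij.2 y
  | inr None => gq ij.2 y + -1 * gp ij.1 y
  | inr (Some k) => z k y end.
pose U (ij : option I * option I) (k : J) x := match k with
  | inl (inl k) => p0 k x - p0 ij.1 x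
  | inl (inr k) => q0 ij.2 x - q0 k x
  | inr None => p0 ij.1 x - q0 ij.2 x
  | inr (Some k) => w k x end.
have linL ij k : linear_form d (L ij k).
  by case: k => [[k|k]|[k|]] /=; [exact/linD/linZ..|exact: linz|exact/linD/linZ].
have cJ : #|{: J}| = (3 * #|I|.+1)%N by rewrite !card_sum !card_option; lia.
have cI : #|{: option I * option I}| = (#|I|.+1 * #|I|.+1)%N.
  by rewrite card_prod card_option.
rewrite [cover_number _ _]/= -cI -cJ.
apply: cover_iff (cover_exists (F := fun ij x y =>
  ((forall k, L ij k y <= U ij k x) /\ (forall k, (k < d)%N -> `|y k| <= M)) /\
  q0 ij.2 x + gq ij.2 y <= y d <= p0 ij.1 x + gp ij.1 y) _) (leqnn _) _.
  move=> ij; apply: cover_lift => //; first exact: IH.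
  by move=> x y [h _]; have := h (inr None) => /=; lra.
move=> x y; split.
- move=> [hl hM].
  have hd := hM d (ltnSn d).
  case: (@Order.TotalTheory.arg_minP _ _ _ None predT (fun o => p0 o x + gp o y) isT) => i _ imin.
  case: (@Order.TotalTheory.arg_maxP _ _ _ None predT (fun o => q0 o x + gq o y) isT) => j _ jmax.
  have pi : y d <= p0 i x + gp i y.
    case: (i) => [i'|]; first by have [] := (consE i' x y hd).1 (hl i').
    by rewrite /p0 /gp addr0; move: hd; rewrite ler_norml => /andP[].
  have qj : q0 j x + gq j y <= y d.
    case: (j) => [i'|]; first by have [] := (consE i' x y hd).1 (hl i').
    by rewrite /q0 /gq addr0; move: hd; rewrite ler_norml => /andP[].
  exists (i, j); split; last by rewrite /= qj.
  split; last by move=> k kd; apply: hM; rewrite leqW.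
  case=> [[k|k]|[k|]] /=.
  + by have := imin k isT; lra.
  + by have h : q0 k x + gq k y <= q0 j x + gq j y := jmax k isT; lra.
  + by have [] := (consE k x y hd).1 (hl k).
  + by lra.
- move=> [[i j] /= [[hL hM] /andP[h1 h2]]].
  have pk k : y d <= p0 k x + gp k y by have := hL (inl (inl k)) => /=; lra.
  have qk k : q0 k x + gq k y <= y d by have := hL (inl (inr k)) => /=; lra.
  have hd : `|y d| <= M.
    have := pk None; have := qk None; rewrite /p0 /gp /q0 /gq !addr0 => ? ?.
    by rewrite ler_norml; apply/andP.
  split=> [k|k].
    by apply/consE => //; split=> //; apply: (hL (inr (Some k))).
  by rewrite ltnS leq_eqVlt; case: eqP => [-> //|_ /= kd]; apply: hM.
Qed.

End Cover.

(** * From real boxes to integer boxes *)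

Section Rank.
Variables (R : realFieldType) (Y : finType) (m : Y -> R).

(** Real coordinates are replaced by ranks, with ties broken by the enumeration
    of [Y], so that points get distinct integers and closed intervals become
    intervals of integers. *)
Definition before y y' := (m y < m y') || ((m y == m y') && (enum_rank y < enum_rank y')%N).
Definition rank y := #|[set y' | before y' y]|.

Lemma rank_lt y : (rank y < #|Y|)%N.
Proof.
rewrite -cardsT; apply/proper_card/properP; split; first exact: subsetT.
by exists y; rewrite ?inE // /before ltxx ltnn andbF.
Qed.

Lemma rank_mono y y' : before y y' -> (rank y < rank y')%N.
Proof.
move=> yy'; apply/proper_card/properP; split.
  apply/subsetP => z; rewrite !inE; move: yy'; rewrite /before.
  move=> /orP[h|/andP[/eqP <- h]] /orP[h'|/andP[/eqP -> h']]; rewrite ?h ?h' //.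
  - by rewrite (lt_trans h' h).
  - by rewrite eqxx (ltn_trans h' h) orbT.
by exists y; rewrite inE // /before ltxx ltnn andbF.
Qed.

Lemma rank_inj : injective rank.
Proof.
move=> y y' ryy'; apply/eqP; apply: contraT => ne.
have : before y y' || before y' y.
  rewrite /before; case: (ltgtP (m y) (m y')) => //= _.
  case: ltngtP => //= h; move: ne; rewrite -(inj_eq enum_rank_inj) -val_eqE /= h eqxx //.
by case/orP => /rank_mono; rewrite ryy' ltnn.
Qed.

Lemma rank_interval a c y :
  (a <= m y <= c) =
  (#|[set y' | (m y' < a)%R]| <= rank y < #|[set y' | (m y' <= c)%R]|)%N.
Proof.
congr (_ && _).
  case: lerP => h; apply/esym.
    apply/subset_leq_card/subsetP => z; rewrite !inE /before => za.
    by rewrite (lt_le_trans za h).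
  apply/negbTE; rewrite -ltnNge; apply/proper_card/properP; split.
    apply/subsetP => z; rewrite !inE => /orP[zy|/andP[/eqP -> //]].
    exact: lt_trans zy h.
  by exists y; rewrite !inE // /before ltxx ltnn andbF.
case: lerP => h; apply/esym.
  apply/proper_card/properP; split.
    apply/subsetP => z; rewrite !inE => /orP[zy|/andP[/eqP -> //]].
    exact: le_trans (ltW zy) h.
  by exists y; rewrite !inE // /before ltxx ltnn andbF.
apply/negbTE; rewrite -leqNgt; apply/subset_leq_card/subsetP => z.
by rewrite !inE /before => zc; rewrite (le_lt_trans zc h).
Qed.
End Rank.

(** The bound for boxes in dimension [d]: [controlled1] and [controlledP] for
    [nX] boxes and [nY] points. *)
Definition box_bound d s b D nX nY : nat := match d with
  | k.+2 => 20 * s * (3 * D) ^ k.+1 * nY + 20 * s * (3 ^ k.+1 * D ^ k * b ^ k.+1) * nX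
  | _ => 5 * s * nY + 5 * s * nX
  end.

Lemma biclique_free_sub (X Y : finType) s (e e' : X -> Y -> bool) :
  (forall x y, e' x y -> e x y) -> biclique_free s e -> biclique_free s e'.
Proof.
by move=> sub free S T sS sT h; apply: (free S T) => // x y xS yT; apply/sub/h.
Qed.

Lemma box_edges (R : realFieldType) (X Y : finType) (s b D d : nat)
    (e : X -> Y -> bool) (on : pred X) (m : nat -> Y -> R) (lo hi : X -> nat -> R) :
  (0 < s)%N -> (0 < b)%N -> (0 < D)%N -> (#|Y| <= b ^ D)%N -> biclique_free s e ->
  (forall x y, e x y <->
     on x /\ forall k, (k < d.+1)%N -> lo x k <= m k y <= hi x k) ->
  (edges e setT setT <= box_bound d.+1 s b D #|X| #|Y|)%N.
Proof.
move=> s0 b0 D0 YbD free eE.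
pose r k := rank (m k).
pose lo' k x := #|[set y | m k y < lo x k]|; pose hi' k x := #|[set y | m k y <= hi x k]|.
have rI k : injective (r k) := @rank_inj _ _ (m k).
have rD k y : (r k y < b ^ D)%N := leq_trans (rank_lt (m k) y) YbD.
have boxE n x y : in_box r lo' hi' n x y <-> forall k, (k < n)%N -> lo x k <= m k y <= hi x k.
  elim: n => [|n IH] /=; first by split.
  rewrite -rank_interval; split=> [/andP[/IH h1 h2] k|h].
    by rewrite ltnS leq_eqVlt => /orP[/eqP -> //|]; apply: h1.
  by apply/andP; split; [apply/IH => k kn; apply/h/leqW|apply: h].
have ctrl alpha beta : controlled e r lo' hi' alpha beta d.+1 ->
    (edges e setT setT <= alpha * #|Y| + beta * #|X|)%N.
  move=> c; rewrite (edges_splitl _ _ _ on).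
  rewrite [X in (_ + X)%N]edges0 ?addn0; last first.
    move=> x y; rewrite !inE /= => nx _; apply/negP => /eE [onx _].
    by rewrite onx in nx.
  apply: leq_trans (c _ _ _) _.
    move=> x y; rewrite inE => /andP[_ onx] _; apply/idP/idP.
      by move/eE => [_ h]; apply/boxE.
    by move/boxE => h; apply/eE.
  by rewrite cardsT leq_add2l leq_mul2l max_card orbT.
case: d eE ctrl => [|d] eE ctrl.
  exact/ctrl/(controlled1 s0 free rI).
exact/ctrl/(controlledP s0 free rI rD b0 D0).
Qed.

Lemma cover_edges (R : realFieldType) (X Y : finType) (s b D d N : nat)
    (pt : Y -> nat -> R) F (e : X -> Y -> bool) :
  (0 < s)%N -> (0 < b)%N -> (0 < D)%N -> (#|Y| <= b ^ D)%N -> biclique_free s e ->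
  box_cover d.+1 N F -> (forall x y, e x y <-> F x (pt y)) ->
  (edges e setT setT <= N * box_bound d.+1 s b D #|X| #|Y|)%N.
Proof.
move=> s0 b0 D0 YbD free cF; elim: cF e free => {N F}
    [N F no|N F N0 [m [on [lo [hi [fm FE]]]]]|N1 N2 N F1 F2 F _ IH1 _ IH2 leN FE] e free eF.
- by rewrite edges0 // => x y _ _; apply/negP => /eF /no.
- apply: leq_trans (leq_pmull _ N0).
  apply: (box_edges (on := fun x => `[<on x>]) (m := fun k y => m k (pt y))
    (lo := lo) (hi := hi)) => // x y.
  by rewrite eF FE; split=> -[h1 h2]; split=> //; apply/asboolP.
- pose e1 x y := `[<F1 x (pt y)>]; pose e2 x y := `[<F2 x (pt y)>].
  have eE x y : e x y = e1 x y || e2 x y.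
    apply/idP/idP => [/eF/FE [h|h]|/orP[/asboolP h|/asboolP h]].
    + by apply/orP; left; apply/asboolP.
    + by apply/orP; right; apply/asboolP.
    + by apply/eF/FE; left.
    + by apply/eF/FE; right.
  have free1 : biclique_free s e1.
    by apply: biclique_free_sub free => x y h; rewrite eE h.
  have free2 : biclique_free s e2.
    by apply: biclique_free_sub free => x y h; rewrite eE h orbT.
  have h1 := IH1 e1 free1 (fun x y => iff_sym (rwP (asboolP _))).
  have h2 := IH2 e2 free2 (fun x y => iff_sym (rwP (asboolP _))).
  have := leq_mul leN (leqnn (box_bound d.+1 s b D #|X| #|Y|)).
  rewrite mulnDl; apply: leq_trans; apply: leq_trans (leq_add h1 h2).
  rewrite /edges -big_split; apply: leq_sum => x _; rewrite -big_split.
  by apply: leq_sum => y _; rewrite eE /=; case: (e1 x y); case: (e2 x y).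
Qed.

(** * Depth and branching of the trees *)

(** [3 > (6/5)^6] and [ln (6/5) >= 1/6]. *)
Lemma ln3_gt1 (R : realType) : 1 < ln (3 : R).
Proof.
have h : 1 <= ln ((6 / 5 : R) ^+ 6).
  rewrite lnXn; last by lra.
  have -> : (6 / 5 : R) = (1 - 6^-1)^-1 by field.
  rewrite lnV; last by rewrite posrE; lra.
  have h6 : -1 < - 6^-1 :> R by lra.
  by have := le_ln1Dx h6; rewrite -mulr_natr; lra.
apply: (le_lt_trans h); rewrite ltr_ln ?posrE //; last by rewrite exprn_gt0; lra.
by rewrite !exprS expr0; lra.
Qed.

(** With [v = ln n], take [D] of order [(2k + 2) v / ln v] and [b] least with
    [n <= b ^ D].  Then [(b - 1) ^ D < n] gives [(b - 1) ^ (2k + 2) <= v], so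
    [b ^ (k + 1)] is of order [sqrt v], which [ln v <= 2 sqrt v] bounds by
    [2 v / ln v]. *)
Lemma tree_parameters (R : realType) n k : (3 <= n)%N ->
  let L : R := ln n%:R / ln (ln n%:R) in
  1 <= L /\ exists b D, [/\ (0 < b)%N, (0 < D)%N, (n <= b ^ D)%N,
    D%:R <= (2 * k + 3)%:R * L & (b ^ k.+1)%:R <= (2 ^ k.+2)%:R * L].
Proof.
move=> n3 L.
have n0 : 0 < n%:R :> R by rewrite ltr0n; lia.
set v : R := ln n%:R in L *.
have v1 : 1 < v.
  apply: (lt_le_trans (ln3_gt1 R)); rewrite ler_ln ?posrE // ?(ler_nat R 3) //.
have v0 : 0 < v := lt_trans ltr01 v1.
have w0 : 0 < ln v by rewrite ln_gt0.
have L1 : 1 <= L by rewrite /L ler_pdivlMr // mul1r ltW // ln_sublinear.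
split=> //.
pose K : R := (2 * k + 2)%:R * L.
have K0 : 0 <= K by rewrite mulr_ge0 // ltW // (lt_le_trans ltr01 L1).
pose D := (Num.truncn K).+1.
have /andP[D1 D2] := truncn_itv K0.
have exb : exists b, (n <= b ^ D)%N.
  by exists n; rewrite -[leqLHS]expn1 leq_pexp2l //; lia.
case: (ex_minnP exb) => b nb bmin.
have b2 : (2 <= b)%N.
  rewrite ltnNge; apply/negP => b1.
  have : (b ^ D <= 1 ^ D)%N by rewrite leq_exp2r.
  by rewrite exp1n; lia.
have b2' : (b <= 2 * b.-1)%N by lia.
have bn : ((b.-1) ^ D < n)%N.
  by rewrite ltnNge; apply/negP => /bmin; lia.
exists b, D; split=> //; first by lia.
  have -> : (2 * k + 3)%:R = (2 * k + 2)%:R + 1 :> R by rewrite natr1 -addnS.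
  by rewrite /D -natr1 mulrDl mul1r -/K lerD.
pose c : R := (b.-1)%:R.
have c1 : 1 <= c by rewrite /c (ler_nat R 1); lia.
have c0 : 0 < c := lt_le_trans ltr01 c1.
have lnc0 : 0 <= ln c by rewrite ln_ge0.
have cv : c ^+ (2 * k + 2) <= v.
  rewrite -ler_ln ?posrE ?exprn_gt0 // lnXn // -mulr_natl.
  have h1 : K * ln c <= v.
    apply: (@le_trans _ _ (D%:R * ln c)); first by rewrite ler_wpM2r // ltW.
    rewrite mulr_natl -lnXn // ler_ln ?posrE ?exprn_gt0 //.
    by rewrite -natrX ler_nat ltnW.
  have e : K * ln c = ((2 * k + 2)%:R * ln c / ln v) * v by rewrite /K /L; field; lra.
  rewrite e in h1.
  have := h1; rewrite -[leRHS]mul1r ler_pM2r // ler_pdivrMr // mul1r.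
  exact.
pose s := Num.sqrt v.
have s0 : 0 < s by rewrite sqrtr_gt0.
have s2 : s ^+ 2 = v by rewrite sqr_sqrtr // ltW.
have lnv : ln v <= 2 * s.
  by have := ln_sublinear s0; rewrite -s2 lnXn // mulr2n; lra.
have cs : c ^+ k.+1 <= s.
  rewrite -(@ler_pXn2r _ 2) ?nnegrE ?exprn_ge0 ?(ltW c0) ?(ltW s0) // s2 -exprM.
  by rewrite mulSn addnC [(k * 2)%N]mulnC; exact: cv.
have sL : s <= 2 * L.
  have e : 2 * v = s * (2 * s) by rewrite -s2; ring.
  by rewrite /L mulrA ler_pdivlMr // e ler_pM2l.
have bc : b%:R <= 2 * c by rewrite /c -natrM ler_nat.
rewrite !natrX.
apply: (@le_trans _ _ ((2 * c) ^+ k.+1)).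
  by apply: lerXn2r; rewrite ?nnegrE ?ler0n ?mulr_ge0 ?(ltW c0).
rewrite exprMn [2%:R ^+ k.+2]exprSr -mulrA ler_pM2l ?exprn_gt0 //.
exact: le_trans cs sL.
Qed.

Definition box_constant d : nat := (20 * 3 ^ d * ((2 * d + 1) ^ d * 2 ^ d.+1))%N.

(** Both costs of [box_bound] are of order [s * L ^ d] in dimension [d.+1]: in
    the cost of a box, the power of [b] is absorbed by the one factor [L] saved
    in the plane. *)
Lemma box_bound_le (R : realType) n d s : (3 <= n)%N ->
  let L : R := ln n%:R / ln (ln n%:R) in
  1 <= L /\ exists b D, [/\ (0 < b)%N, (0 < D)%N, (n <= b ^ D)%N &
    forall nX nY, (nX + nY = n)%N ->
      (box_bound d.+1 s b D nX nY)%:R <= (box_constant d)%:R * s%:R * n%:R * L ^+ d].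
Proof.
move=> n3 L; have [L1 _] := @tree_parameters R n 0 n3; split=> //.
case: d => [|k].
  exists n, 1%N; split=> //; [by lia|].
  move=> nX nY <-; rewrite expr0 mulr1 -!natrM ler_nat /= /box_constant.
  by rewrite expn0 expn1 !muln1; nia.
have [_ [b [D [b0 D0 nb DL bL]]]] := @tree_parameters R n k n3.
exists b, D; split=> // nX nY nE.
rewrite -/L in L1 DL bL; move: L L1 DL bL => L L1 DL bL.
have L0 : 0 <= L := le_trans ler01 L1.
have E : (2 * k.+1 + 1 = 2 * k + 3)%N by lia.
pose Q : R := ((2 * k + 3) ^ k.+1 * 2 ^ k.+2)%:R * L ^+ k.+1.
have Dk (i : nat) : D%:R ^+ i <= ((2 * k + 3) ^ i)%:R * L ^+ i.
  by rewrite natrX -exprMn; apply: lerXn2r; rewrite ?nnegrE ?ler0n ?mulr_ge0.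
have h1 : (D ^ k.+1)%:R <= Q.
  rewrite natrX (le_trans (Dk _)) // /Q ler_wpM2r ?exprn_ge0 // ler_nat.
  by rewrite leq_pmulr // expn_gt0.
have h2 : (D ^ k * b ^ k.+1)%:R <= Q.
  rewrite natrM natrX (le_trans (ler_pM _ _ (Dk k) bL)) ?exprn_ge0 //.
  rewrite mulrACA -exprSr -natrM /Q ler_wpM2r ?exprn_ge0 // ler_nat.
  by rewrite leq_mul2r leq_exp2l ?leqnSn ?orbT //; lia.
have -> : (box_bound k.+2 s b D nX nY)%:R =
    (20 * s * 3 ^ k.+1)%:R * ((D ^ k.+1)%:R * nY%:R + (D ^ k * b ^ k.+1)%:R * nX%:R) :> R.
  rewrite -!natrM -natrD -natrM; congr (_%:R); rewrite /= expnMn; lia.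
have -> : (box_constant k.+1)%:R * s%:R * n%:R * L ^+ k.+1 =
    (20 * s * 3 ^ k.+1)%:R * (Q * nY%:R + Q * nX%:R) :> R.
  by rewrite -mulrDr -natrD addnC nE /box_constant E /Q !natrM; ring.
by rewrite ler_wpM2l ?ler0n // lerD // ler_wpM2r.
Qed.

(** * Semilinear graphs *)

Lemma Kss_free_biclique (U V : choiceType) (G : bipartite_graph U V) s :
  Kss_free s (edge_rel G) -> biclique_free s (@adj U V G).
Proof.
move=> free S T sS sT full; apply: free.
have enumI (W : finType) : injective (fun x : W => val (enum_rank x)).
  by move=> x y /val_inj /enum_rank_inj.
have [v Sv] := initial_segment (enumI _) sS.
have [w Tw] := initial_segment (enumI _) sT.
exists [set inl x | x in [set x in S | (val (enum_rank x) < v)%N]],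
  [set inr y | y in [set y in T | (val (enum_rank y) < w)%N]]; split.
- by rewrite card_imset // => x y [].
- by rewrite card_imset // => x y [].
- rewrite disjoint_subset; apply/subsetP => _ /imsetP[x _ ->].
  by rewrite inE; apply/negP => /imsetP[].
- move=> _ _ /imsetP[x + ->] /imsetP[y + ->]; rewrite !inE.
  by move=> /andP[xS _] /andP[yT _]; apply: full.
Qed.

Lemma num_edgesE (U V : choiceType) (G : bipartite_graph U V) :
  num_edges G = edges (@adj U V G) setT setT.
Proof.
rewrite /num_edges -sum1_card /edges pair_big /= big_mkcond [RHS]big_mkcond /=.
by apply: eq_bigr => p _; rewrite !inE; case: (adj _ _).
Qed.

(** For each disjunct [j], the points [y] adjacent to [x] form a polyhedron with
    normals independent of [x], and the finitely many points [y] of the graph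
    lie in a cube. *)
Lemma semilinear_edges (R : realType) (dx d h t s b D : nat)
    (G : bipartite_graph 'rV[R]_dx 'rV[R]_d.+1) :
  (0 < s)%N -> (0 < b)%N -> (0 < D)%N -> (#|{: rclass G}| <= b ^ D)%N ->
  Kss_free s (edge_rel G) -> semilinear_graph h t G ->
  (num_edges G <= t * (cover_number d.+1 h *
     box_bound d.+1 s b D #|{: lclass G}| #|{: rclass G}|))%N.
Proof.
move=> s0 b0 D0 YbD /Kss_free_biclique free [f [faff fE]].
pose pt (y : rclass G) k : R := val y 0 (inord k).
pose ej j (x : lclass G) (y : rclass G) := `[<forall i, f i j (val x, val y) <= 0>].
have sub j x y : ej j x y -> adj x y.
  by move/asboolP => h1; apply/fE; exists j.
have one j : (edges (ej j) setT setT <= cover_number d.+1 h *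
    box_bound d.+1 s b D #|{: lclass G}| #|{: rclass G}|)%N.
  have sep i : exists p : ((nat -> R) -> R) * (lclass G -> R), linear_form d.+1 p.1 /\
      forall x y, f i j (val x, val y) <= 0 <-> p.1 (pt y) <= p.2 x.
    have [a [c [e feq]]] := faff i j.
    exists (fun y : nat -> R => \sum_(k < d.+1) c 0 (inord k) * y k,
            fun x : lclass G => - (\sum_(k < dx) a 0 k * (val x) 0 k + e)); split=> /=.
      by exists (fun k => c 0 (inord k)).
    move=> x y; rewrite feq.
    have -> : \sum_(k < d.+1) c 0 (inord k) * pt y k = \sum_(k < d.+1) c 0 k * val y 0 k.
      by apply: eq_bigr => k _; rewrite /pt inord_val.
    by split; lra.
  have [p pP] := fin_all_exists sep.
  pose M : R := \sum_(y : rclass G) \sum_(k < d.+1) `|val y 0 k|.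
  have ptM y k : (k < d.+1)%N -> `|pt y k| <= M.
    move=> kd; rewrite /M (bigD1 y) //= (bigD1 (inord k)) //= -addrA lerDl.
    by rewrite addr_ge0 ?sumr_ge0 // => y' _; rewrite sumr_ge0.
  have cov := polyhedron_cover (fun i => (p i).2) M (fun i => (pP i).1).
  rewrite card_ord in cov.
  apply: (cover_edges (pt := pt) s0 b0 D0 _ _ cov).
  - exact: YbD.
  - exact: biclique_free_sub (sub j) free.
  - move=> x y; split=> [/asboolP h1|[h1 _]].
      by split=> [i|k /(ptM y) //]; apply/(pP i).2.
    by apply/asboolP => i; apply/(pP i).2.
rewrite num_edgesE; apply: (@leq_trans (\sum_(j < t) edges (ej j) setT setT)).
  rewrite /edges [leqRHS]exchange_big /=; apply: leq_sum => x _.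
  rewrite [leqRHS]exchange_big /=; apply: leq_sum => y _.
  case xy: (adj x y) => //=; have /fE [j h1] := xy.
  by rewrite (bigD1 j) //= (_ : ej j x y = true) //; apply/asboolP.
set W := (cover_number d.+1 h * _)%N.
have -> : (t * W = \sum_(j < t) W)%N by rewrite sum_nat_const card_ord.
by apply: leq_sum => j _; exact: one.
Qed.

Theorem theorem1p7 (R : realType) (dx h : nat) (dx_gt0 : (0 < dx)%N)
    (h_gt0 : (0 < h)%N) :
  exists C : R, 0 < C /\
    forall (dy t s n : nat) (G : bipartite_graph 'rV[R]_dx 'rV[R]_dy),
      (1 <= dy <= dx)%N -> (1 <= t)%N -> (1 <= s)%N -> (3 <= n)%N ->
      #|vertex G| = n ->
      Kss_free s (edge_rel G) ->
      semilinear_graph h t G ->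
      (num_edges G)%:R <=
        C * t%:R * s%:R * n%:R * (ln n%:R / ln (ln n%:R)) ^+ (dy - 1).
Proof.
pose K d := (cover_number d.+1 h * box_constant d)%N.
pose C := (\sum_(d < dx) K d)%N.
exists (1 + C%:R); split; first by rewrite ltr_pwDl.
move=> [//|d] t s n G /andP[_ ddx] t1 s1 n3 Gn free semi.
rewrite subn1 /=.
have XY : (#|{: lclass G}| + #|{: rclass G}| = n)%N.
  by rewrite -Gn /vertex card_sum.
have [L1 [b [D [b0 D0 nb bound]]]] := @box_bound_le R n d s n3.
set L := ln _ / _ in L1 bound *.
have := semilinear_edges s1 b0 D0 _ free semi.
have YbD : (#|{: rclass G}| <= b ^ D)%N by rewrite (leq_trans _ nb) // -XY leq_addl.
move=> /(_ YbD) edge_le.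
have L0 : 0 <= L ^+ d by rewrite exprn_ge0 // (le_trans ler01 L1).
have KC : (K d <= C)%N.
  by rewrite /C (bigD1 (Ordinal ddx)) //= leq_addr.
apply: (@le_trans _ _ (t * (cover_number d.+1 h *
     box_bound d.+1 s b D #|{: lclass G}| #|{: rclass G}|))%:R); first by rewrite ler_nat.
apply: (@le_trans _ _ ((K d)%:R * t%:R * s%:R * n%:R * L ^+ d)).
  have -> : (K d)%:R = (cover_number d.+1 h)%:R * (box_constant d)%:R :> R.
    exact: natrM.
  set N := cover_number _ _; set c := box_constant d in bound *.
  rewrite natrM [X in _ * X <= _]natrM.
  apply: (@le_trans _ _ (t%:R * (N%:R * (c%:R * s%:R * n%:R * L ^+ d)))).
    by rewrite !ler_wpM2l // bound.
  by rewrite le_eqVlt; apply/orP; left; apply/eqP; ring.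
do 4 (rewrite ler_wpM2r //).
by rewrite (@le_trans _ _ C%:R) ?ler_nat // lerDr.
Qed.
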